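(* For every fixed integer $k\ge 3$ there exists $m_0=m_0(k)$ such that the following holds. Let $m\ge m_0$ be an integer with $m=\binom{k}{2}+kq+r$, where $q,r$ are integers and $1\le r\le k-1$. If $G$ is a connected $W_{2k+1}$-free graph with exactly $m$ edges, then $$\rho(G)\le \rho(S_{k,m}),$$ and equality holds if and only if $G\cong S_{k,m}$.
   Context: All graphs are finite, simple and undirected. $\rho(G)$ denotes the adjacency spectral radius of $G$. $W_{2k+1}=K_1\vee C_{2k}$ is the graph obtained from a cycle of length $2k$ by adding a vertex adjacent to all cycle vertices; a graph is $W_{2k+1}$-free if it contains no (not necessarily induced) subgraph isomorphic to $W_{2k+1}$. $\vee$ denotes the join of graphs and $qK_1$ the graph of $q$ isolated vertices. For $m=\binom{k}{2}+kq+r$ with $1\le r\le k-1$, the graph $S_{k,m}$ is obtained from $K_k\vee qK_1$ by adding a new vertex $z$ and joining it to exactly $r$ vertices of the $K_k$; it has exactly $m$ edges. *)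

(* Defs.v *)
From mathcomp Require Import all_boot all_order all_algebra all_field.

Set Implicit Arguments.
Unset Strict Implicit.
Unset Printing Implicit Defensive.

Import Order.TTheory GRing.Theory Num.Theory.

Record sgraph := SGraph {
  vertex :> finType;
  adj : rel vertex;
  adj_sym : symmetric adj;
  adj_irrefl : irreflexive adj }.

Definition edges (G : sgraph) : {set {set G}} :=
  [set [set p.1; p.2] | p : G * G & adj p.1 p.2].

Definition connected_graph (G : sgraph) : Prop :=
  0 < #|G| /\ forall x y : G, connect (@adj G) x y.

Definition isomorphic (G H : sgraph) : Prop :=
  exists f : G -> H, bijective f /\ forall x y, adj (f x) (f y) = adj x y.

(* Not necessarily induced: non-edges of [H] may be mapped to edges of [G]. *)
Definition has_subgraph (H G : sgraph) : Prop :=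
  exists f : H -> G, injective f /\ forall x y, adj x y -> adj (f x) (f y).

Definition subgraph_free (H G : sgraph) : Prop := ~ has_subgraph H G.

Section Complete.
Variable n : nat.

Definition complete_rel : rel 'I_n := [rel i j | i != j].

Lemma complete_sym : symmetric complete_rel.
Proof. by move=> i j; rewrite /complete_rel /= eq_sym. Qed.

Lemma complete_irrefl : irreflexive complete_rel.
Proof. by move=> i; rewrite /complete_rel /= eqxx. Qed.

Definition complete_graph : sgraph := SGraph complete_sym complete_irrefl.
End Complete.

Section Edgeless.
Variable n : nat.

Definition edgeless_rel : rel 'I_n := [rel i j | false].

Lemma edgeless_sym : symmetric edgeless_rel.
Proof. by []. Qed.

Lemma edgeless_irrefl : irreflexive edgeless_rel.
Proof. by []. Qed.

Definition edgeless_graph : sgraph := SGraph edgeless_sym edgeless_irrefl.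
End Edgeless.

(* [ordS] is the successor modulo [n]; this is the cycle of length [n] only
   for [3 <= n]. *)
Section Cycle.
Variable n : nat.

Definition cycle_rel : rel 'I_n :=
  [rel i j | (i != j) && ((j == ordS i) || (i == ordS j))].

Lemma cycle_sym : symmetric cycle_rel.
Proof. by move=> i j; rewrite /cycle_rel /= eq_sym orbC. Qed.

Lemma cycle_irrefl : irreflexive cycle_rel.
Proof. by move=> i; rewrite /cycle_rel /= eqxx. Qed.

Definition cycle_graph : sgraph := SGraph cycle_sym cycle_irrefl.
End Cycle.

Section Join.
Variables G H : sgraph.

Definition join_rel : rel (G + H)%type := fun u v =>
  match u, v with
  | inl x, inl y => adj x y
  | inr x, inr y => adj x y
  | _, _ => true
  end.

Lemma join_sym : symmetric join_rel.
Proof. by case=> x [] y //=; rewrite adj_sym. Qed.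

Lemma join_irrefl : irreflexive join_rel.
Proof. by case=> x /=; rewrite adj_irrefl. Qed.

Definition join_graph : sgraph := SGraph join_sym join_irrefl.
End Join.

(* [G] with a new vertex [None] whose neighbourhood is [A]. *)
Section AddVertex.
Variables (G : sgraph) (A : {set G}).

Definition add_vertex_rel : rel (option G) := fun u v =>
  match u, v with
  | Some x, Some y => adj x y
  | Some x, None | None, Some x => x \in A
  | None, None => false
  end.

Lemma add_vertex_sym : symmetric add_vertex_rel.
Proof. by case=> [x|] [y|] //=; rewrite adj_sym. Qed.

Lemma add_vertex_irrefl : irreflexive add_vertex_rel.
Proof. by case=> [x|] //=; rewrite adj_irrefl. Qed.

Definition add_vertex : sgraph := SGraph add_vertex_sym add_vertex_irrefl.
End AddVertex.

(* The wheel on [n] vertices, for [4 <= n]. *)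
Definition wheel (n : nat) : sgraph :=
  join_graph (complete_graph 1) (cycle_graph n.-1).

(* S_{k,m} for m = 'C(k, 2) + k * q + r with 1 <= r <= k - 1 (such q and r are
   determined by k and m); the new vertex is joined to the first [r] vertices
   of the clique. *)
Definition S_graph (k q r : nat) : sgraph :=
  @add_vertex (join_graph (complete_graph k) (edgeless_graph q))
    [set inl i | i : 'I_k & i < r].

Local Open Scope ring_scope.

(* Rows and columns follow the enumeration of the vertices.  The matrix is
   integral, so its complex eigenvalues all lie in [algC]. *)
Definition adj_matrix (G : sgraph) : 'M[algC]_#|G| :=
  \matrix_(i, j) (adj (enum_val i) (enum_val j))%:R.

(* The complex eigenvalues, with multiplicity. *)
Definition eigenvalues (n : nat) (A : 'M[algC]_n) : seq algC :=
  sval (closed_field_poly_normal (char_poly A)).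

Definition spectral_radius (n : nat) (A : 'M[algC]_n) : algC :=
  \big[Num.max/0]_(a <- eigenvalues A) `|a|.

Definition rho (G : sgraph) : algC := spectral_radius (adj_matrix G).

(* Main.v *)
Require Import Defs.
From mathcomp Require Import all_boot all_order all_algebra all_field.
From mathcomp Require Import zify ring lra.

(** Let x be the Perron vector of G, normalised so that its largest entry is
    x u = 1, let lam = rho G, N = N(u) and let W be the set of vertices outside
    N and different from u.  Expanding lam^2 = lam^2 x u along walks of length
    two and comparing with the number m of edges gives
      lam^2 - m = sum_(vw in E(N)) (x v + x w - 1)
                  - sum_(w in W) (1 - x w) d_N(w) - e(W),
    while lam >= rho S forces lam^2 - (k-1) lam >= m - O(1).  Measure subsets of
    N by the sum of their entries of x, so that N has mass lam.  The wheel
    condition excludes K_(k,k) from N(u), so by pigeonhole the vertices of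
    N seeing a positive proportion of N contribute at most (k-1) lam + O(1) to
    the right-hand side, and all other edges of N contribute little.  Hence W
    consists, up to small mass, of twins of u, and these number at most
    lam / (24 k): otherwise both sides of an almost complete bipartite graph would
    need degree about k-1, and a vertex with k-1 neighbours among the twins
    leaves only a matching on the other side.  Once the twins are few, the
    identity has only O(1) slack, which yields k-1 neighbours of u with entries
    1 - O(1/lam^2); comparing O(1) terms exactly shows that with u they form a
    clique K and that there is no further vertex of large weight.  Finally,
    summing the eigenvalue equation over K gives
      k^2 q + r^2 <= sum_(b notin K) d_K(b)^2,
    and since the d_K(b) are at most k with sum at most k q + r, convexity leaves
    only S. *)

Set Implicit Arguments.
Unset Strict Implicit.
Unset Printing Implicit Defensive.

Import Order.TTheory GRing.Theory Num.Theory.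

(** The competitor that shapes the argument is the join of two (k-1)-regular graphs on s vertices
    each: it has lam = s + k - 1 and lam^2 - (k-1) lam = m, so it would beat S, and bounding the
    degrees inside the two sides by k-1 does not exclude it. A second wheel does: its hub lies in
    one side and its rim uses a path on three vertices of the other. This lowers the admissible sum
    of the two degrees from 2(k-1) to 2k-3, and that single unit is what defeats many twins. The
    number kq + r^2/k enters twice. A test vector on S gives it as a lower bound for rho^2 - (k-1)
    rho, and it falls short of m by at most C = k(k-1)/2 + k/4, because r(k-r)/k <= k/4. The exact C
    matters: excluding a further heavy vertex amounts to refuting k-1 < (k+1)/2, which is tight at k
    = 3. Later the unrounded number is compared with the sum of d_K(b)^2 / k, and integrality
    absorbs every error that tends to 0. The estimates are proved for arbitrary constants subject to
    inequalities, which are fixed only at the end. *)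

Definition nbr (G : sgraph) (u : G) : {set G} := [set w | adj u w].

(** * Finding wheels *)

Section Wheels.
Variable G : sgraph.

Lemma wheel_of_cycle n (c : G) (f : nat -> G) :
  (forall i j, i < n -> j < n -> f i = f j -> i = j) ->
  (forall i, i < n -> adj (f i) (f (i.+1 %% n))) ->
  (forall i, i < n -> adj c (f i)) ->
  has_subgraph (wheel n.+1) G.
Proof.
move=> f_inj f_cycle c_f.
have c_neq i : i < n -> c <> f i.
  by move=> lt_i E; have := c_f _ lt_i; rewrite -E adj_irrefl.
exists (fun z : wheel n.+1 =>
  match z with inl _ => c | inr i => f (nat_of_ord (i : 'I_n)) end); split.
  case=> [i|i] [j|j] //=.
  - by rewrite (ord1 i) (ord1 j).
  - by move/(c_neq _ (ltn_ord j)).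
  - by move/esym/(c_neq _ (ltn_ord i)).
  - by move/(f_inj _ _ (ltn_ord i) (ltn_ord j))/val_inj->.
case=> [i|i] [j|j] //=.
- by rewrite /complete_rel /= (ord1 i) (ord1 j) eqxx.
- by move=> _; apply: c_f; exact: (ltn_ord j).
- by move=> _; rewrite adj_sym; apply: c_f; exact: (ltn_ord i).
case/andP => _ /orP[] /eqP->; last rewrite adj_sym.
  exact: f_cycle (ltn_ord i).
exact: f_cycle (ltn_ord j).
Qed.

(** Even places of the rim are taken by [p] and odd ones by [q], the shape in which rims arise
    inside bicliques. *)
Lemma wheel_of_alternating_cycle k (c : G) (p q : nat -> G) :
  (forall i j, i < k -> j < k -> p i = p j -> i = j) ->
  (forall i j, i < k -> j < k -> q i = q j -> i = j) ->
  (forall i j, i < k -> j < k -> p i <> q j) ->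
  (forall i, i < k -> adj (p i) (q i)) ->
  (forall i, i < k -> adj (q i) (p (i.+1 %% k))) ->
  (forall i, i < k -> adj c (p i) /\ adj c (q i)) ->
  has_subgraph (wheel (2 * k + 1)) G.
Proof.
move=> p_inj q_inj pq_neq pq qp c_pq; rewrite addn1.
apply: (@wheel_of_cycle _ c (fun i => if odd i then q i./2 else p i./2)).
- move=> i j lt_i lt_j; have lt_i2 : i./2 < k by lia.
  have lt_j2 : j./2 < k by lia.
  case: ifP => oi; case: ifP => oj.
  + by move/(q_inj _ _ lt_i2 lt_j2); lia.
  + by move/esym/(pq_neq _ _ lt_j2 lt_i2).
  + by move/(pq_neq _ _ lt_i2 lt_j2).
  + by move/(p_inj _ _ lt_i2 lt_j2); lia.
- move=> i lt_i; have lt_i2 : i./2 < k by lia.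
  have [lt_i1|ge_i1] := ltnP i.+1 (2 * k).
    rewrite modn_small //=; case: ifP => oi /=.
      have -> : uphalf i = i./2.+1 %% k by rewrite modn_small; lia.
      exact: qp.
    have -> : uphalf i = i./2 by lia.
    exact: pq.
  (* The last rim vertex is [q k.-1]; its successor wraps around to [p 0]. *)
  have Ei : i = (k.-1).*2.+1 by lia.
  have -> : i.+1 = 2 * k by lia.
  rewrite modnn /= Ei /= odd_double /= uphalf_double.
  have -> : p 0 = p ((k.-1).+1 %% k).
    by rewrite prednK ?modnn //; lia.
  by apply: qp; lia.
- move=> i lt_i; have lt_i2 : i./2 < k by lia.
  by have [] := c_pq _ lt_i2; case: ifP.
Qed.

Lemma wheel_of_biclique k (c : G) (P Q : {set G}) :
  k <= #|P| -> k <= #|Q| ->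
  {in P & Q, forall p q, adj p q} ->
  {in P, forall p, adj c p} -> {in Q, forall q, adj c q} ->
  has_subgraph (wheel (2 * k + 1)) G.
Proof.
move=> kP kQ PQ cP cQ.
have in_P i : i < k -> nth c (enum P) i \in P.
  by move=> lt_i; rewrite -mem_enum mem_nth // -cardE (leq_trans lt_i).
have in_Q i : i < k -> nth c (enum Q) i \in Q.
  by move=> lt_i; rewrite -mem_enum mem_nth // -cardE (leq_trans lt_i).
apply: (@wheel_of_alternating_cycle _ c (nth c (enum P)) (nth c (enum Q))).
- move=> i j lt_i lt_j /eqP; rewrite nth_uniq ?enum_uniq -?cardE ?(leq_trans lt_i kP) ?(leq_trans lt_j kP) //.
  by move/eqP.
- move=> i j lt_i lt_j /eqP; rewrite nth_uniq ?enum_uniq -?cardE ?(leq_trans lt_i kQ) ?(leq_trans lt_j kQ) //.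
  by move/eqP.
- move=> i j lt_i lt_j E; have := PQ _ _ (in_P _ lt_i) (in_Q _ lt_j).
  by rewrite E adj_irrefl.
- by move=> i lt_i; apply: PQ; [apply: in_P | apply: in_Q].
- move=> i lt_i; rewrite adj_sym; apply: PQ; last exact: in_Q.
  by apply: in_P; rewrite ltn_mod (leq_trans _ lt_i).
- by move=> i lt_i; split; [apply/cP/in_P | apply/cQ/in_Q].
Qed.

(* The rim is b2 b3 a1 b4 a2 b5 ... a_(k-1) b1, where the a's run through P and
   b4, b5, ... through Q. *)
Lemma wheel_of_path3 k (c b1 b2 b3 : G) (P Q : {set G}) :
  k.-1 <= #|P| -> k.-2 <= #|Q| -> 3 <= k ->
  adj b1 b2 -> adj b2 b3 -> b1 != b3 ->
  b1 \notin Q -> b2 \notin Q -> b3 \notin Q ->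
  {in P, forall p, adj p b1 /\ adj p b3} -> b2 \notin P ->
  {in P & Q, forall p q, adj p q} ->
  {in P, forall p, adj c p} -> {in Q, forall q, adj c q} ->
  adj c b1 -> adj c b2 -> adj c b3 ->
  has_subgraph (wheel (2 * k + 1)) G.
Proof.
move=> kP kQ k3.
have lt_pred i : i.+1 < k -> i < k.-1 by lia.
have lt_P i : i.+1 < k -> i < #|P| by lia.
have last_eq i : i < k -> k <= i.+1 -> i = k.-2.+1 by lia.
have k2E : k.-2.+2 = k by lia.
have last_inj i j : i.+1 < k -> j.+1 < k -> (i < k.-2) = false ->
  (j < k.-2) = false -> i.+1 = j.+1 by lia.
move=> b12 b23 b13 b1Q b2Q b3Q Pb b2P PQ cP cQ cb1 cb2 cb3.
have in_P i : i < k.-1 -> nth c (enum P) i \in P.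
  by move=> lt_i; rewrite -mem_enum mem_nth // -cardE (leq_trans lt_i).
have in_Q i : i < k.-2 -> nth c (enum Q) i \in Q.
  by move=> lt_i; rewrite -mem_enum mem_nth // -cardE (leq_trans lt_i).
pose p i := if i is j.+1 then nth c (enum P) j else b2.
pose q i := if i is j.+1 then (if j < k.-2 then nth c (enum Q) j else b1) else b3.
have q_nadj i : i < k -> q i = b1 \/ q i = b3 \/ q i \in Q.
  case: i => [|j] lt_j /=; first by right; left.
  by case: ifP => [/in_Q|]; [right; right | left].
have Pq i z : i < k -> z \in P -> adj z (q i).
  by move=> /q_nadj[->|[->|qQ]] zP; [case: (Pb z zP) | case: (Pb z zP) | apply: PQ].
apply: (@wheel_of_alternating_cycle _ c p q).
- move=> [|i] [|j] lt_i lt_j //= E.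
  + by move: b2P; rewrite E in_P //; apply: lt_pred.
  + by move: b2P; rewrite -E in_P //; apply: lt_pred.
  + move/eqP: E; rewrite nth_uniq ?enum_uniq -?cardE ?(lt_P _ lt_i) ?(lt_P _ lt_j) //.
    by move/eqP->.
- move=> [|i] [|j] lt_i lt_j //=.
  + case: ifP => [ltj|_] E; first by move: b3Q; rewrite E in_Q.
    by move: b13; rewrite E eqxx.
  + case: ifP => [lti|_] E; first by move: b3Q; rewrite -E in_Q.
    by move: b13; rewrite E eqxx.
  + case: ifP => [lti|gei]; case: ifP => [ltj|gej] E.
    * move/eqP: E; rewrite nth_uniq ?enum_uniq -?cardE ?(leq_trans lti kQ) //
        ?(leq_trans ltj kQ) //; by move/eqP->.
    * by move: b1Q; rewrite -E in_Q.
    * by move: b1Q; rewrite E in_Q.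
    * exact: last_inj.
- move=> [|i] j lt_i lt_j /= E.
    case: (q_nadj j lt_j) => [F|[F|F]].
    + by move: b12; rewrite E F adj_irrefl.
    + by move: b23; rewrite E F adj_irrefl.
    + by move: b2Q; rewrite E F.
  by have := Pq j _ lt_j (in_P _ (lt_pred _ lt_i)); rewrite E adj_irrefl.
- by move=> [|i] lt_i //=; apply: (Pq i.+1) => //; apply/in_P/lt_pred.
- move=> i lt_i; have [lt_i1|ge_i1] := ltnP i.+1 k.
    by rewrite modn_small // adj_sym /=; apply: Pq => //; apply/in_P/lt_pred.
  by rewrite (last_eq i) // k2E modnn /= ltnn.
- move=> i lt_i; split.
    by case: i lt_i => [|i] lt_i //=; apply/cP/in_P/lt_pred.
  by case: (q_nadj i lt_i) => [->|[->|/cQ]].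
Qed.

End Wheels.

(** * Sums of squares and the graph S *)

(* The maximum of a sum of squares of integers in [0, k] with sum n. *)
Definition max_squares (k n : nat) := k ^ 2 * (n %/ k) + (n %% k) ^ 2.

Lemma max_squaresE k a b : b < k -> max_squares k (a * k + b) = k ^ 2 * a + b ^ 2.
Proof.
move=> bk; have k_gt0 : 0 < k by apply: leq_ltn_trans bk.
by rewrite /max_squares divnMDl // modnMDl divn_small // modn_small // addn0.
Qed.

(** Only the remainder of [n] modulo [k] interacts with [d]: merging two parts, or filling one up to
    [k], increases the sum of squares by convexity. The strict case later makes the extremal
    configuration unique. *)
Lemma max_squares_add k n d : 0 < k -> d <= k ->
  max_squares k n + d ^ 2 <= max_squares k (n + d) /\
  (0 < d < k -> 0 < n %% k -> max_squares k n + d ^ 2 < max_squares k (n + d)).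
Proof.
move=> k_gt0 dk; have [a [b [bk ->]]] : exists a b, b < k /\ n = a * k + b.
  by exists (n %/ k), (n %% k); rewrite ltn_pmod // -divn_eq.
rewrite modnMDl (modn_small bk).
have -> : a * k + b + d = a * k + (b + d) by rewrite addnA.
rewrite (max_squaresE _ bk); have [lt_k|ge_k] := ltnP (b + d) k.
  by rewrite max_squaresE //; split=> [|/andP[d0 _] b0]; nia.
have [f E] : exists f, b + d = k + f by exists (b + d - k); lia.
have -> : a * k + (b + d) = a.+1 * k + f by rewrite E; lia.
have f_lt : f < k by lia.
rewrite max_squaresE //.
have [g E2] : exists g, k = d + g by exists (k - d); lia.
have bE : b = f + g by lia.
rewrite bE E2 in bk f_lt *; clear -bk.
by split=> [|/andP[d0 dlt] b0]; nia.
Qed.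

Lemma max_squaresS k n : 0 < k -> max_squares k n < max_squares k n.+1.
Proof.
move=> k_gt0; have [+ _] := @max_squares_add k n 1 k_gt0 k_gt0.
by rewrite addn1 exp1n addn1.
Qed.

Lemma max_squares_sum k (I : eqType) (s : seq I) (d : I -> nat) : 0 < k ->
  {in s, forall i, d i <= k} ->
  \sum_(i <- s) d i ^ 2 <= max_squares k (\sum_(i <- s) d i).
Proof.
move=> k_gt0; elim: s => [|i s IH] dk; first by rewrite !big_nil.
rewrite !big_cons addnC [d i + _]addnC.
have [+ _] := @max_squares_add k (\sum_(j <- s) d j) (d i) k_gt0 (dk i (mem_head i s)).
by apply: leq_trans; rewrite leq_add2r IH // => j js; rewrite dk // inE js orbT.
Qed.

(** The lower bound on squares equals [max_squares k (k * q + r)], so every convexity estimate is an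
    equality. As [max_squares] is strictly increasing, the deficit [e] vanishes; as [k] does not
    divide the sum, some [d i0] lies strictly between 0 and [k], and the strict form of
    [max_squares_add] leaves a multiple of [k] to the others. *)
Lemma deficit_unique k q r e (I : finType) (A : {set I}) (d : I -> nat) :
  0 < r < k -> {in A, forall i, d i <= k} ->
  \sum_(i in A) d i + e = k * q + r ->
  k ^ 2 * q + r ^ 2 <= \sum_(i in A) d i ^ 2 ->
  e = 0 /\ exists2 i0, i0 \in A &
    d i0 = r /\ {in A, forall i, i != i0 -> d i = 0 \/ d i = k}.
Proof.
move=> /andP[r_gt0 r_lt] dk sum_d sum_sq.
have k_gt0 : 0 < k by apply: leq_ltn_trans r_lt.
have bound (D : {set I}) : D \subset A ->
    \sum_(i in D) d i ^ 2 <= max_squares k (\sum_(i in D) d i).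
  move=> DA; rewrite -big_filter -[X in max_squares k X]big_filter; apply: max_squares_sum => // i.
  by rewrite mem_filter => /andP[/(subsetP DA)/dk].
have mono n1 n2 : max_squares k n1 + n2 <= max_squares k (n1 + n2).
  elim: n2 => [|n2 IH]; first by rewrite !addn0.
  by rewrite !addnS; apply: leq_ltn_trans IH _; apply: max_squaresS.
have sqE : max_squares k (k * q + r) = k ^ 2 * q + r ^ 2.
  by rewrite mulnC max_squaresE.
have e0 : e = 0.
  have := bound A (subxx _); have := mono (\sum_(i in A) d i) e.
  by rewrite sum_d sqE; move: sum_sq; clear; lia.
split=> //; rewrite e0 addn0 in sum_d.
have [/existsP[i0 /andP[i0A d0]]|none] := boolP [exists i, (i \in A) && (0 < d i < k)]; last first.
  have : k %| \sum_(i in A) d i.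
    apply: dvdn_sum => i iA; have := dk i iA; rewrite leq_eqVlt => /orP[/eqP->|lt_k].
      exact: dvdnn.
    have := forallP (etrans (esym (negb_exists _)) none) i.
    by rewrite iA lt_k andbT /= -eqn0Ngt => /eqP->; apply: dvdn0.
  by rewrite sum_d dvdn_addr ?dvdn_mulr // gtnNdvd.
exists i0 => //; have rest_sub : A :\ i0 \subset A by exact: subsetDl.
set n' := \sum_(i in A :\ i0) d i.
have sumE : n' + d i0 = k * q + r by rewrite -sum_d (big_setD1 i0) //= addnC.
have sqsE : \sum_(i in A) d i ^ 2 = \sum_(i in A :\ i0) d i ^ 2 + d i0 ^ 2.
  by rewrite (big_setD1 i0) //= addnC.
have b' := bound _ rest_sub; rewrite -/n' in b'.
have dk0 := dk _ i0A; have [_ strict] := @max_squares_add k n' (d i0) k_gt0 dk0.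
have mod0 : n' %% k = 0.
  apply/eqP; rewrite -leqn0 leqNgt; apply/negP => /(strict d0).
  by rewrite sumE sqE; move: sum_sq b'; rewrite sqsE; clear; lia.
have n'E : n' = n' %/ k * k by rewrite {1}(divn_eq n' k) mod0 addn0.
have d0r : d i0 = r.
  have /eqP := congr1 (modn^~ k) sumE.
  rewrite n'E modnMDl mulnC modnMDl !modn_small //; last by case/andP: d0.
  by move/eqP.
(* The remaining values satisfy d^2 <= k d termwise, while their sums satisfy the reverse
   inequality. *)
split=> // i iA i_neq.
have sq' : \sum_(i in A :\ i0) k * d i <= \sum_(i in A :\ i0) d i ^ 2.
  rewrite -big_distrr /= -/n'; move: sum_sq; rewrite sqsE d0r leq_add2r.
  apply: leq_trans; rewrite expnS expn1 -mulnA leq_mul2l; apply/orP; right.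
  by move: sumE; rewrite d0r => /addIn->.
have term j : j \in A :\ i0 -> d j ^ 2 <= k * d j.
  by move=> /(subsetP rest_sub)/dk ?; rewrite expnS expn1 leq_mul2r; apply/orP; right.
have iD : i \in A :\ i0 by rewrite in_setD1 i_neq.
have : \sum_(j in (A :\ i0) :\ i) d j ^ 2 <= \sum_(j in (A :\ i0) :\ i) k * d j.
  by apply: leq_sum => j /setD1P[_]; apply: term.
move: sq'; rewrite (big_setD1 i iD) [X in _ <= X](big_setD1 i iD) /= => h1 h2.
have : k * d i <= d i ^ 2 by move: h1 h2; clear; lia.
rewrite expnS expn1 leq_mul2r => /orP[/eqP->|k_le]; [by left | right].
by apply/eqP; rewrite eqn_leq k_le dk.
Qed.

Lemma S_graph_iso (G : sgraph) (K : {set G}) (b0 : G) k q r :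
  #|K| = k -> #|G| = k + q + 1 -> b0 \notin K -> #|K :&: nbr b0| = r ->
  {in K &, forall y z, y != z -> adj y z} ->
  {in ~: K &, forall y z, ~~ adj y z} ->
  {in ~: K, forall b, b != b0 -> {in K, forall z, adj z b}} ->
  isomorphic G (S_graph k q r).
Proof.
move=> cardK cardG b0K nb0 K_clique B_indep B_full.
(* Neighbours of [b0] are listed first, since [S_graph] joins its new vertex to the clique vertices
   of index below [r]. *)
pose LK := enum (K :&: nbr b0) ++ enum (K :\: nbr b0).
pose LB := enum ((~: K) :\ b0).
have size_LK : size LK = k by rewrite size_cat -!cardE cardsID.
have mem_LK z : (z \in LK) = (z \in K).
  by rewrite mem_cat !mem_enum in_setI in_setD; case: (z \in K); case: (z \in nbr b0).
have uniq_LK : uniq LK.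
  rewrite cat_uniq !enum_uniq andbT /=; apply/hasPn => z; rewrite !mem_enum.
  by rewrite in_setI in_setD => /andP[/negbTE-> _]; rewrite andbF.
have size_LB : size LB = q.
  have := cardsC K; have := cardsD1 b0 (~: K); rewrite in_setC b0K -cardE.
  by rewrite cardG cardK; lia.
have mem_LB z : (z \in LB) = (z != b0) && (z \notin K).
  by rewrite mem_enum in_setD1 in_setC.
have uniq_LB : uniq LB by exact: enum_uniq.
pose g (v : S_graph k q r) : G := match v with
  | None => b0
  | Some (inl i) => nth b0 LK (i : 'I_k)
  | Some (inr j) => nth b0 LB (j : 'I_q) end.
have gK (i : 'I_k) : nth b0 LK i \in K by rewrite -mem_LK mem_nth // size_LK.
have gB (j : 'I_q) : (nth b0 LB j != b0) && (nth b0 LB j \notin K).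
  by rewrite -mem_LB mem_nth // size_LB.
have adj_b0 (i : 'I_k) : adj (nth b0 LK i) b0 = (i < r).
  rewrite adj_sym /LK nth_cat -cardE nb0; case: ltnP => [lt_r|ge_r].
    have : nth b0 (enum (K :&: nbr b0)) i \in enum (K :&: nbr b0).
      by rewrite mem_nth // -cardE nb0.
    by rewrite mem_enum !inE => /andP[_ ->].
  have : nth b0 (enum (K :\: nbr b0)) (i - r) \in enum (K :\: nbr b0).
    rewrite mem_nth // -cardE; have := cardsID (nbr b0) K; rewrite cardK nb0.
    by have := ltn_ord i; lia.
  by rewrite mem_enum !inE => /andP[/negbTE-> _].
have g_adj v w : adj (g v) (g w) = adj v w.
  case: v w => [[i|j]|] [[i'|j']|] //=.
  - rewrite /complete_rel /=; case: (eqVneq i i') => [->|neq]; first by rewrite adj_irrefl.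
    by rewrite K_clique ?gK // nth_uniq ?size_LK.
  - by have /andP[n1 n2] := gB j'; apply: B_full; rewrite ?in_setC ?gK.
  - rewrite adj_b0; apply/idP/imsetP => [lt_r|[i' i'r [->]]]; last by rewrite inE in i'r.
    by exists i; rewrite ?inE.
  - rewrite adj_sym; have /andP[n1 n2] := gB j.
    by apply: B_full; rewrite ?in_setC ?gK.
  - have /andP[_ n2] := gB j; have /andP[_ n2'] := gB j'.
    by apply/negbTE/B_indep; rewrite in_setC.
  - have /andP[_ n2] := gB j; have -> : adj (nth b0 LB j) b0 = false.
      by apply/negbTE/B_indep; rewrite in_setC.
    by apply/esym/negbTE/imsetP => -[i _].
  - rewrite adj_sym adj_b0; apply/idP/imsetP => [lt_r|[i i'r [->]]]; last by rewrite inE in i'r.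
    by exists i'; rewrite ?inE.
  - have /andP[_ n2] := gB j'; have -> : adj b0 (nth b0 LB j') = false.
      by apply/negbTE/B_indep; rewrite in_setC.
    by apply/esym/negbTE/imsetP => -[i _].
  - by rewrite adj_irrefl.
have g_inj : injective g.
  case=> [[i|j]|] [[i'|j']|] //= E.
  - move/eqP: E; rewrite nth_uniq ?size_LK // => /eqP/val_inj-> //.
  - by have := gB j'; rewrite -E gK andbF.
  - by have := gK i; rewrite E (negbTE b0K).
  - by have := gB j; rewrite E gK andbF.
  - move/eqP: E; rewrite nth_uniq ?size_LB // => /eqP/val_inj-> //.
  - by have := gB j; rewrite E eqxx.
  - by have := gK i'; rewrite -E (negbTE b0K).
  - by have := gB j'; rewrite -E eqxx.
have [f fK gfK] : bijective g.
  apply: inj_card_bij g_inj _.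
  by rewrite cardG card_option card_sum !card_ord addn1.
exists f; split; first by exists g.
by move=> y z; rewrite -g_adj !gfK.
Qed.

Lemma sum_adj_edges (G : sgraph) :
  \sum_(v : G) \sum_(w : G) (adj v w : nat) = 2 * #|edges G|.
Proof.
rewrite pair_big /=.
rewrite (eq_bigr (fun p : G * G => if adj p.1 p.2 then 1 else 0)); last first.
  by move=> p _; case: adj.
rewrite -big_mkcond /= (partition_big (fun p : G * G => [set p.1; p.2]) (mem (edges G))) /=.
  rewrite mulnC -sum_nat_const; apply: eq_bigr => E /imsetP[[v w]].
  rewrite inE /= => vw ->; rewrite sum1_card.
  have v_neq_w : v != w by apply/eqP => F; rewrite F adj_irrefl in vw.
  have -> : 2 = #|[set (v, w); (w, v)]|.
    by rewrite cards2; case: eqP => // -[F _]; rewrite F eqxx in v_neq_w.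
  apply: eq_card => -[v' w']; rewrite in_set2 unfold_in /=; apply/idP/idP.
    case/andP => vw' /eqP/setP E2.
    have v'w' : v' != w' by apply/eqP => F; rewrite F adj_irrefl in vw'.
    have := E2 v'; have := E2 w'; rewrite !in_set2 !eqxx orbT /=.
    move=> /esym/orP[]/eqP Ew /esym/orP[]/eqP Ev; rewrite Ev Ew ?eqxx ?orbT //;
      by rewrite Ev Ew eqxx in v'w'.
  by case/orP => /eqP[-> ->]; rewrite ?vw ?eqxx //= adj_sym vw setUC eqxx.
by move=> p vw; apply/imsetP; exists p; rewrite ?inE.
Qed.

Local Open Scope ring_scope.

(** * Perron vectors *)

Section Spectrum.
Local Open Scope sesquilinear_scope.

Lemma mem_eigenvalues n (A : 'M[algC]_n) a :
  (a \in eigenvalues A) = eigenvalue A a.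
Proof.
rewrite eigenvalue_root_char /eigenvalues.
case: closed_field_poly_normal => s /= {1}->.
by rewrite (monicP (char_poly_monic A)) scale1r root_prod_XsubC.
Qed.

Lemma spectral_radius_real n (A : 'M[algC]_n) : spectral_radius A \is Num.real.
Proof. by apply: bigmax_real => // a _; exact: normr_real. Qed.

Lemma le_spectral_radius n (A : 'M[algC]_n) a :
  eigenvalue A a -> `|a| <= spectral_radius A.
Proof.
rewrite -mem_eigenvalues /spectral_radius; elim: (eigenvalues A) => //= b s IH.
have bs : \big[Num.max/0]_(j <- s) `|j| \is Num.real.
  by apply: bigmax_real => // c _; exact: normr_real.
rewrite big_cons inE => /orP[/eqP-> | /IH le_a].
  by rewrite comparable_le_max ?lexx // real_comparable ?normr_real.
by rewrite comparable_le_max ?le_a ?orbT // real_comparable ?normr_real.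
Qed.

Lemma spectral_radius_ge0 n (A : 'M[algC]_n) : 0 <= spectral_radius A.
Proof.
rewrite /spectral_radius; elim: (eigenvalues A) => [|b s IH]; first by rewrite big_nil.
by rewrite big_cons /Num.max; case: ifP.
Qed.

Lemma spectral_radius_attained n (A : 'M[algC]_n) : (0 < n)%N ->
  exists2 a, eigenvalue A a & `|a| = spectral_radius A.
Proof.
move=> n_gt0; have [a0 Aa0] := eigenvalue_closed A n_gt0.
have: eigenvalues A != [::].
  by apply/eqP => E; move: Aa0; rewrite -mem_eigenvalues E.
suff attained (s : seq algC) : s != [::] ->
    exists2 a, a \in s & `|a| = \big[Num.max/0]_(j <- s) `|j|.
  by case/attained => a; rewrite mem_eigenvalues; exists a.
elim: s => // b [|c s] IH _.
  by exists b; rewrite ?mem_head // big_cons big_nil max_l.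
have [//|a a_in a_max] := IH.
rewrite big_cons -a_max /Num.max; case: ifP => _.
  by exists a; rewrite // inE a_in orbT.
by exists b; rewrite ?mem_head.
Qed.

Lemma adj_matrix_sym (G : sgraph) : (adj_matrix G)^T = adj_matrix G.
Proof. by apply/matrixP => i j; rewrite !mxE adj_sym. Qed.

Lemma adj_matrix_real (G : sgraph) : (adj_matrix G)^t* = adj_matrix G.
Proof.
by rewrite adj_matrix_sym; apply/matrixP => i j; rewrite !mxE conjC_nat.
Qed.

Lemma adj_matrix_hermitian (G : sgraph) : adj_matrix G \is hermsymmx.
Proof. by apply/is_hermitianmxP; rewrite expr0 scale1r adj_matrix_real. Qed.

(** In a unitary eigenbasis the form of rho I - A is diagonal. Its coefficients turn out
    nonnegative, so it yields the Rayleigh bound and also detects eigenvectors. *)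
Lemma rho_form (G : sgraph) (y : 'rV[algC]_#|G|) :
  let P := spectralmx (adj_matrix G) in
  let z := y *m invmx P in
  (y *m ((rho G)%:M - adj_matrix G) *m y^t*) 0 0 =
  \sum_i (rho G - spectral_diag (adj_matrix G) 0 i) * `|z 0 i| ^+ 2.
Proof.
move=> P z; pose A := adj_matrix G; pose d := spectral_diag A.
have PU : P \is unitarymx := spectral_unitarymx A.
have Pu : P \in unitmx := spectral_unit A.
have AE : A = invmx P *m diag_mx d *m P.
  by apply/orthomx_spectralP/hermitian_normalmx/adj_matrix_hermitian.
have -> : (rho G)%:M - A = invmx P *m ((rho G)%:M - diag_mx d) *m P.
  by rewrite mulmxBr mulmxBl -AE mul_mx_scalar -scalemxAl mulVmx // scalemx1.
have -> : (y *m (invmx P *m ((rho G)%:M - diag_mx d) *m P) *m y^t*) =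
   z *m ((rho G)%:M - diag_mx d) *m z^t*.
  by rewrite /z trmx_mul map_mxM !mulmxA invmx_unitary // trmxCK.
rewrite mxE; apply: eq_bigr => i _; rewrite mulmxBr mul_mx_scalar mul_mx_diag.
by rewrite !mxE normCK; ring.
Qed.

Lemma spectral_diag_le_rho (G : sgraph) i : spectral_diag (adj_matrix G) 0 i <= rho G.
Proof.
pose A := adj_matrix G; pose d := spectral_diag A; pose P := spectralmx A.
have Pu : P \in unitmx := spectral_unit A.
have AE : A = invmx P *m diag_mx d *m P.
  by apply/orthomx_spectralP/hermitian_normalmx/adj_matrix_hermitian.
have d_real : d 0 i \is Num.real.
  by have /mxOverP/(_ 0 i) := hermitian_spectral_diag_real (adj_matrix_hermitian G).
apply: le_trans (real_ler_norm d_real) _; apply: le_spectral_radius.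
apply/eigenvalueP; exists (row i P).
  have PA : P *m A = diag_mx d *m P by rewrite AE !mulmxA mulmxV // mul1mx.
  rewrite -[LHS]row_mul PA; apply/rowP => j.
  by rewrite [LHS]mxE mul_diag_mx !mxE.
apply/eqP => Pi0; have /matrixP/(_ i i) := mulmxV Pu.
rewrite !mxE eqxx => /eqP; rewrite big1 ?(eq_sym 0) ?oner_eq0 // => j _.
by have /rowP/(_ j) := Pi0; rewrite !mxE => ->; rewrite mul0r.
Qed.

Lemma rho_form_ge0 (G : sgraph) (y : 'rV[algC]_#|G|) :
  0 <= (y *m ((rho G)%:M - adj_matrix G) *m y^t*) 0 0.
Proof.
rewrite rho_form; apply: sumr_ge0 => i _.
by rewrite mulr_ge0 ?exprn_ge0 // subr_ge0 spectral_diag_le_rho.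
Qed.

(** A vanishing sum of nonnegative terms kills every coordinate whose eigenvalue differs from
    rho. *)
Lemma rho_form_eq0 (G : sgraph) (y : 'rV[algC]_#|G|) :
  (y *m ((rho G)%:M - adj_matrix G) *m y^t*) 0 0 <= 0 ->
  y *m adj_matrix G = rho G *: y.
Proof.
move=> form_le0; pose A := adj_matrix G; pose d := spectral_diag A.
pose P := spectralmx A; pose z := y *m invmx P.
have Pu : P \in unitmx := spectral_unit A.
have AE : A = invmx P *m diag_mx d *m P.
  by apply/orthomx_spectralP/hermitian_normalmx/adj_matrix_hermitian.
have term_ge0 i : true -> 0 <= (rho G - d 0 i) * `|z 0 i| ^+ 2.
  by move=> _; rewrite mulr_ge0 ?exprn_ge0 // subr_ge0 spectral_diag_le_rho.
have /eqP : (y *m ((rho G)%:M - A) *m y^t*) 0 0 = 0.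
  by apply/eqP; rewrite eq_le form_le0 rho_form_ge0.
rewrite rho_form psumr_eq0 // => /allP all0.
have zD : z *m diag_mx d = rho G *: z.
  rewrite mul_mx_diag; apply/rowP => i; rewrite !mxE.
  have := all0 i (mem_index_enum i); rewrite /= mulf_eq0 subr_eq0.
  case/orP => [/eqP <-|]; first by rewrite mulrC.
  by rewrite expf_eq0 /= normr_eq0 -/A -/P -/z => /eqP; rewrite mxE => ->; rewrite mul0r mulr0.
by rewrite -/A AE !mulmxA zD -scalemxAl mulmxKV.
Qed.

Lemma rho_real (G : sgraph) : rho G \is Num.real.
Proof. exact: spectral_radius_real. Qed.

(** The order of [algC] is partial; the real algebraic numbers [algR] form an ordered field, where
    linear arithmetic is available. *)
Definition rhoR (G : sgraph) : algR := in_algR (rho_real G).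

Lemma rhoR_ge0 (G : sgraph) : 0 <= rhoR G.
Proof. exact: (spectral_radius_ge0 (adj_matrix G)). Qed.

Lemma conj_algRval (x : algR) : (algRval x)^* = algRval x.
Proof. by apply/CrealP; case: x. Qed.

Section Functions.
Variable G : sgraph.
Implicit Types x y : G -> algR.

Definition row_of y : 'rV[algC]_#|G| := \row_i algRval (y (enum_val i)).

Lemma sum_enum_val (F : G -> algC) : \sum_(i < #|G|) F (enum_val i) = \sum_v F v.
Proof. by rewrite -big_enum_val. Qed.

Lemma mul_row_of_adj y :
  row_of y *m adj_matrix G =
  row_of (fun v => \sum_w (adj v w)%:R * y w).
Proof.
apply/rowP => i; rewrite !mxE rmorph_sum.
rewrite -(sum_enum_val (fun w => algRval ((adj (enum_val i) w)%:R * y w))).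
by apply: eq_bigr => j _; rewrite !mxE rmorphM rmorph_nat adj_sym mulrC.
Qed.

Lemma rho_form_row_of y :
  (row_of y *m ((rho G)%:M - adj_matrix G) *m (row_of y)^t*) 0 0 =
  algRval (\sum_v (rhoR G * y v - \sum_w (adj v w)%:R * y w) * y v).
Proof.
rewrite mulmxBr mul_row_of_adj mul_mx_scalar mxE rmorph_sum.
rewrite -(sum_enum_val (fun v => algRval
  ((rhoR G * y v - \sum_w (adj v w)%:R * y w) * y v))).
apply: eq_bigr => i _.
by rewrite !mxE conj_algRval.
Qed.

Lemma rayleigh y :
  \sum_v \sum_w (adj v w)%:R * (y v * y w) <= rhoR G * \sum_v y v ^+ 2.
Proof.
have := rho_form_ge0 (row_of y); rewrite rho_form_row_of => form_ge0.
have {}form_ge0 : 0 <= \sum_v (rhoR G * y v - \sum_w (adj v w)%:R * y w) * y v.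
  exact: form_ge0.
rewrite -subr_ge0 mulr_sumr -sumrB; apply: le_trans form_ge0 _.
rewrite le_eqVlt; apply/orP; left; apply/eqP; apply: eq_bigr => v _.
rewrite mulrBl mulr_suml expr2 mulrA; congr (_ - _).
by apply: eq_bigr => w _; ring.
Qed.

End Functions.

(* An eigenvector for an eigenvalue of maximal modulus is replaced by its
   entrywise modulus, which attains equality in the Rayleigh bound. *)
Lemma perron (G : sgraph) : (0 < #|G|)%N ->
  exists x : G -> algR, exists u : G,
  [/\ forall v, 0 <= x v <= 1, x u = 1 &
      forall v, rhoR G * x v = \sum_w (adj v w)%:R * x w].
Proof.
move=> G_gt0; have [a /eigenvalueP[z zA z_neq0] a_rho] :=
  spectral_radius_attained (adj_matrix G) G_gt0.
pose y (v : G) : algR := in_algR (normr_real (z 0 (enum_rank v))).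
have y_ge0 v : 0 <= y v by exact: (normr_ge0 (z 0 (enum_rank v))).
have y_sub v : rhoR G * y v <= \sum_w (adj v w)%:R * y w.
  have -> : (rhoR G * y v <= \sum_w (adj v w)%:R * y w) =
    (rho G * `|z 0 (enum_rank v)| <= algRval (\sum_w (adj v w)%:R * y w)) by [].
  rewrite /rho -a_rho -normrM.
  have -> : a * z 0 (enum_rank v) = (a *: z) 0 (enum_rank v) by rewrite mxE.
  rewrite -zA mxE; apply: le_trans (ler_norm_sum _ _ _) _.
  rewrite rmorph_sum -(sum_enum_val (fun w => algRval ((adj v w)%:R * y w))).
  apply: ler_sum => i _; rewrite !mxE normrM normr_nat enum_rankK adj_sym.
  by rewrite rmorphM rmorph_nat mulrC /= enum_valK.
have /rho_form_eq0 : (row_of y *m ((rho G)%:M - adj_matrix G) *m (row_of y)^t*) 0 0 <= 0.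
  rewrite rho_form_row_of.
  have : \sum_v (rhoR G * y v - \sum_w (adj v w)%:R * y w) * y v <= 0; last exact.
  by apply: sumr_le0 => v _; rewrite mulr_le0_ge0 // subr_le0.
rewrite mul_row_of_adj => yA.
have y_eig v : rhoR G * y v = \sum_w (adj v w)%:R * y w.
  apply: val_inj; have /rowP/(_ (enum_rank v)) := yA.
  by rewrite !mxE enum_rankK => /esym.
have [v0 y_v0] : exists v, 0 < y v.
  have /rV0Pn[i zi] := z_neq0; exists (enum_val i).
  have : 0 < `|z 0 i| by rewrite normr_gt0.
  by rewrite -{1}(enum_valK i).
have [u _ u_max] := @arg_maxP _ _ _ v0 xpredT y isT.
have y_u : 0 < y u by apply: lt_le_trans y_v0 (u_max v0 isT).
exists (fun v => y v / y u), u; split=> [v||v].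
- by rewrite divr_ge0 //= ler_pdivrMr // mul1r; apply: u_max.
- by rewrite divff // gt_eqF.
- by rewrite mulrA y_eig mulr_suml; apply: eq_bigr => w _; rewrite mulrA.
Qed.

(** The Perron vector of [G], carried along the isomorphism, is a test vector for [H]. The empty
    graph has no Perron vector, but its radius is 0. *)
Lemma rho_iso_le (G H : sgraph) : isomorphic G H -> rhoR G <= rhoR H.
Proof.
move=> [f [f_bij fE]].
have [G_gt0|] := posnP #|G|; last first.
  move=> /perron[x [u [x01 xu x_eig]]]; have [g fK gK] := f_bij.
  have := rayleigh (fun w => x (g w)).
  have bij_sum (F : H -> algR) : \sum_w F w = \sum_v F (f v).
    by rewrite (reindex f) //; apply: onW_bij.
  rewrite !bij_sum; under eq_bigr => v _.
    rewrite bij_sum; under eq_bigr => w _ do rewrite fE !fK mulrCA.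
    rewrite -mulr_sumr -x_eig mulrCA -expr2; over.
  under [X in _ <= _ * X]eq_bigr => v _ do rewrite fK.
  rewrite -mulr_sumr ler_pM2r //.
  rewrite (bigD1 u) //= xu expr1n ltr_pwDl ?ltr01 //.
  by apply: sumr_ge0 => v _; rewrite sqr_ge0.
have -> : rhoR G = 0; last exact: rhoR_ge0.
apply: val_inj; rewrite /= /rho /spectral_radius.
case E : (eigenvalues _) => [|a s]; first by rewrite big_nil.
have : a \in eigenvalues (adj_matrix G) by rewrite E mem_head.
rewrite mem_eigenvalues => /eigenvalueP[z _ /rV0Pn[i]].
by have := ltn_ord i; rewrite [X in (_ < X)%N]G_gt0.
Qed.

End Spectrum.

Lemma sum_option (R : nmodType) (T : finType) (F : option T -> R) :
  \sum_v F v = F None + \sum_t F (Some t).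
Proof.
rewrite (bigD1 None) //=; congr (_ + _).
rewrite (reindex_omap Some id) /=; last by case.
by apply: eq_bigl => t; rewrite eqxx.
Qed.

(** The test vector imitates the eigenvalue equation: with weight rho on the clique, an independent
    vertex gets [k] and the added vertex gets [r]. The indicator of the clique gives the second
    bound. *)
Lemma rho_S_ge k q r : (3 <= k)%N -> (r <= k)%N ->
  k%:R * q%:R + r%:R ^+ 2 / k%:R <=
  rhoR (S_graph k q r) ^+ 2 - (k%:R - 1) * rhoR (S_graph k q r) /\
  k%:R - 1 <= rhoR (S_graph k q r).
Proof.
move=> k3 rk; set S := S_graph k q r; set rho := rhoR S.
pose y (al be ga : algR) (v : S) : algR := match v with
  | None => ga | Some (inl _) => al | Some (inr _) => be end.
have form al be ga : \sum_v \sum_w (adj v w)%:R * (y al be ga v * y al be ga w) =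
   k%:R * (k%:R - 1) * al ^+ 2 + 2 * (k%:R * q%:R * (al * be)) + 2 * (r%:R * (al * ga)).
  have inA : \sum_(i < k) (inl i \in [set (inl i : ('I_k + 'I_q)%type) | i : 'I_k & (i < r)%N])%:R
      = r%:R :> algR.
    transitivity (\sum_(i < k) (i < r)%N%:R : algR).
      apply: eq_bigr => i _; congr ((nat_of_bool _)%:R).
      apply/imsetP/idP => [[i' i'r [->]]|ir]; first by rewrite inE in i'r.
      by exists i; rewrite ?inE.
    rewrite -natr_sum -big_mkcond /= sum1_card; congr (_%:R).
    have cardr : #|[set widen_ord rk i | i : 'I_r]| = r.
      rewrite card_imset ?card_ord //; move=> i j /(congr1 val) /= E.
      exact: val_inj.
    rewrite -[RHS]cardr; apply: eq_card => i; rewrite unfold_in; apply/idP/imsetP => [ir|[j _ ->]].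
      by exists (Ordinal ir) => //; apply: val_inj.
    exact: (ltn_ord j).
  have notA (j : 'I_q) : inr j \in [set (inl i : ('I_k + 'I_q)%type) | i : 'I_k & (i < r)%N] = false.
    by apply/negbTE/imsetP => -[i _].
  have KK : \sum_(i < k) \sum_(j < k) ((i != j)%:R * (al * al)) = k%:R * (k%:R - 1) * al ^+ 2.
    transitivity (\sum_(i < k) ((k%:R - 1) * al ^+ 2)); last first.
      by rewrite sumr_const card_ord -[LHS]mulr_natl mulrA.
    apply: eq_bigr => i _; rewrite (bigD1 i) //= eqxx mul0r add0r.
    rewrite (eq_bigr (fun=> al ^+ 2)) => [|j]; last first.
      by rewrite eq_sym => ->; rewrite mul1r expr2.
    rewrite sumr_const -[LHS]mulr_natl; congr (_ * _).
    transitivity (#|predC1 i|%:R : algR); first by congr (_%:R); apply: eq_card => j.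
    by rewrite cardC1 card_ord -subn1 natrB //; apply: leq_trans k3.
  rewrite sum_option big_sumType /=.
  under [X in _ + (X + _)]eq_bigr => i _ do rewrite sum_option big_sumType /=.
  under [X in _ + (_ + X)]eq_bigr => i _ do rewrite sum_option big_sumType /= notA.
  rewrite sum_option big_sumType /=.
  rewrite !big_split /= -!mulr_suml inA KK.
  rewrite [X in X * (ga * be)]big1 => [|j _]; last by rewrite notA.
  by rewrite !sumr_const !card_ord; ring.
have norm al be ga : \sum_v (y al be ga v) ^+ 2 =
    k%:R * al ^+ 2 + q%:R * be ^+ 2 + ga ^+ 2.
  by rewrite sum_option big_sumType /= !sumr_const !card_ord !mulr_natl addrC.
have k_gt0 : (0 : algR) < k%:R by rewrite ltr0n; apply: leq_trans k3.
have rho_ge : k%:R - 1 <= rho.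
  have := rayleigh (y 1 0 0); rewrite form norm -/rho => le_form.
  by rewrite -(ler_pM2r k_gt0); lra.
have k3R : (3 : algR) <= k%:R by rewrite ler_nat.
split=> //; have rho_gt0 : 0 < rho by apply: lt_le_trans rho_ge; lra.
have := rayleigh (y rho k%:R r%:R); rewrite form norm -/rho => le_form.
rewrite -(ler_pM2r (mulr_gt0 k_gt0 rho_gt0)).
have -> : (k%:R * q%:R + r%:R ^+ 2 / k%:R) * (k%:R * rho) =
  (k%:R ^+ 2 * q%:R + r%:R ^+ 2) * rho by field; rewrite gt_eqF.
by move: le_form; lra.
Qed.

(** * Weighted counting around a vertex of maximal Perron entry *)

Definition far (G : sgraph) (u : G) : {set G} := [set w | (w != u) && ~~ adj u w].

Section Weights.
Variables (R : realFieldType) (G : sgraph).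
Implicit Types (A B C : {set G}) (v w : G).

Definition ind v w : R := (adj v w)%:R.
Definition dg B v : R := \sum_(w in B) ind v w.
Definition mu (x : G -> R) A : R := \sum_(v in A) x v.
(** The eigenvalue equation writes [lam * x v] as a sum of such weighted degrees over a partition of
    the vertices. *)
Definition me (x : G -> R) B v : R := \sum_(w in B) ind v w * x w.

Lemma ind_ge0 v w : 0 <= ind v w. Proof. exact: ler0n. Qed.
Lemma ind_le1 v w : ind v w <= 1. Proof. by rewrite /ind; case: adj. Qed.
Lemma ind_sym v w : ind v w = ind w v. Proof. by rewrite /ind adj_sym. Qed.
Lemma ind_irrefl v : ind v v = 0. Proof. by rewrite /ind adj_irrefl. Qed.
Lemma ind_adj v w : adj v w -> ind v w = 1. Proof. by rewrite /ind => ->. Qed.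
Lemma ind_nadj v w : ~~ adj v w -> ind v w = 0. Proof. by rewrite /ind => /negbTE->. Qed.

Lemma dg_card B v : dg B v = #|B :&: nbr v|%:R.
Proof.
rewrite /dg /ind -natr_sum -big_mkcondr /= sum1_card; congr (_%:R).
by apply: eq_card => w; rewrite !inE.
Qed.

Lemma sum_setU A B (F : G -> R) : [disjoint A & B] ->
  \sum_(v in A :|: B) F v = \sum_(v in A) F v + \sum_(v in B) F v.
Proof.
move=> AB; rewrite -bigU //=; apply: eq_bigl => v.
by rewrite !inE.
Qed.

Lemma sum_setD A B (F : G -> R) : B \subset A ->
  \sum_(v in A) F v = \sum_(v in B) F v + \sum_(v in A :\: B) F v.
Proof.
move=> BA; rewrite -sum_setU; last by rewrite -setI_eq0 setIDA setDIl setDv set0I.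
by apply: eq_bigl => v; rewrite !inE; case: (boolP (v \in B)) => //= /(subsetP BA).
Qed.

Lemma sum_subset A B (F : G -> R) : A \subset B -> {in B, forall v, 0 <= F v} ->
  \sum_(v in A) F v <= \sum_(v in B) F v.
Proof.
move=> AB F0; rewrite (sum_setD F AB) lerDl; apply: sumr_ge0 => v.
by rewrite inE => /andP[_ /F0].
Qed.

Lemma sum_ind_exchange A B (F : G -> G -> R) :
  \sum_(v in A) \sum_(w in B) ind v w * F v w =
  \sum_(w in B) \sum_(v in A) ind w v * F v w.
Proof.
rewrite exchange_big; apply: eq_bigr => w _; apply: eq_bigr => v _.
by rewrite ind_sym.
Qed.

Lemma sum_dg_sym A B : \sum_(v in A) dg B v = \sum_(w in B) dg A w.
Proof.
rewrite /dg exchange_big; apply: eq_bigr => w _; apply: eq_bigr => v _.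
by rewrite ind_sym.
Qed.

Lemma sum_me_dg (x : G -> R) A B :
  \sum_(v in A) me x B v = \sum_(w in B) dg A w * x w.
Proof.
rewrite /me exchange_big; apply: eq_bigr => w _; rewrite mulr_suml.
by apply: eq_bigr => v _; rewrite ind_sym.
Qed.

Lemma dg_ge0 B v : 0 <= dg B v.
Proof. by rewrite dg_card ler0n. Qed.

Lemma dg_le_card B v : dg B v <= #|B|%:R.
Proof. by rewrite dg_card ler_nat subset_leq_card ?subsetIl. Qed.

Lemma dg_subset A B v : A \subset B -> dg A v <= dg B v.
Proof. by move=> AB; apply: sum_subset AB _ => w _; exact: ind_ge0. Qed.

Lemma sum1_mu A : \sum_(v in A) (1 : R) = #|A|%:R.
Proof. by rewrite sumr_const. Qed.

Section Bounded.
Variable x : G -> R.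
Hypothesis x01 : forall v, 0 <= x v <= 1.

Lemma x_ge0 v : 0 <= x v. Proof. by case/andP: (x01 v). Qed.
Lemma x_le1 v : x v <= 1. Proof. by case/andP: (x01 v). Qed.

Lemma mu_ge0 A : 0 <= mu x A.
Proof. by apply: sumr_ge0 => v _; exact: x_ge0. Qed.

Lemma mu_le_card A : mu x A <= #|A|%:R.
Proof. by rewrite -sum1_mu; apply: ler_sum => v _; exact: x_le1. Qed.

Lemma mu_subset A B : A \subset B -> mu x A <= mu x B.
Proof. by move=> AB; apply: sum_subset AB _ => w _; exact: x_ge0. Qed.

Lemma me_term_ge0 v w : 0 <= ind v w * x w.
Proof. by rewrite mulr_ge0 ?ind_ge0 ?x_ge0. Qed.

Lemma me_ge0 B v : 0 <= me x B v.
Proof. by apply: sumr_ge0 => w _; exact: me_term_ge0. Qed.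

Lemma me_le_mu B v : me x B v <= mu x B.
Proof. by apply: ler_sum => w _; rewrite ler_piMl ?ind_le1 ?x_ge0. Qed.

Lemma me_le_dg B v : me x B v <= dg B v.
Proof. by apply: ler_sum => w _; rewrite ler_piMr ?ind_ge0 ?x_le1. Qed.

Lemma me_subset A B v : A \subset B -> me x A v <= me x B v.
Proof. by move=> AB; apply: sum_subset AB _ => w _; exact: me_term_ge0. Qed.

Lemma me_le_dg_bound B v c : {in B, forall w, x w <= c} -> me x B v <= c * dg B v.
Proof.
move=> xc; rewrite /dg mulr_sumr; apply: ler_sum => w wB.
by rewrite mulrC ler_wpM2r ?ind_ge0 ?xc.
Qed.

(** A union bound: a vertex of [A] outside the common neighbourhood is missed by some [z] in [F], so
    its weight is subtracted at least once. *)
Lemma common_mass A (F : {set G}) :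
  mu x A - \sum_(z in F) (mu x A - me x A z) <=
  mu x [set b in A | [forall z in F, adj z b]].
Proof.
have -> : \sum_(z in F) (mu x A - me x A z) =
    \sum_(b in A) x b * \sum_(z in F) (1 - ind z b).
  under [RHS]eq_bigr => b _ do rewrite mulr_sumr.
  rewrite exchange_big; apply: eq_bigr => z _; rewrite /mu /me -sumrB.
  by apply: eq_bigr => b _; ring.
rewrite /mu -sumrB.
have -> : \sum_(v in [set b in A | [forall z in F, adj z b]]) x v =
    \sum_(b in A) (if [forall z in F, adj z b] then x b else 0).
  by rewrite -big_mkcondr; apply: eq_bigl => b; rewrite !inE.
apply: ler_sum => b _; case: ifP => [_|].
  rewrite gerBl mulr_ge0 ?x_ge0 // sumr_ge0 // => z _.
  by rewrite subr_ge0 ind_le1.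
move/negbT; rewrite negb_forall => /existsP[z]; rewrite negb_imply => /andP[zF zb].
rewrite (bigD1 z) //= ind_nadj // subr0.
have : 0 <= \sum_(i in F | i != z) (1 - ind i b).
  by apply: sumr_ge0 => i _; rewrite subr_ge0 ind_le1.
have := x_ge0 b; nra.
Qed.

Lemma common_card A (F : {set G}) k :
  k%:R <= mu x A - \sum_(z in F) (mu x A - me x A z) ->
  (k <= #|[set b in A | [forall z in F, adj z b]]|)%N.
Proof.
move=> le_k; rewrite -(ler_nat R); apply: le_trans (mu_le_card _).
exact: le_trans le_k (common_mass _ _).
Qed.

End Bounded.
End Weights.

Lemma set_of_card (T : finType) (A : {set T}) k : (k <= #|A|)%N ->
  exists2 B : {set T}, B \subset A & #|B| = k.
Proof.
move=> kA; exists [set z in take k (enum A)].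
  by apply/subsetP => z; rewrite inE => /mem_take; rewrite mem_enum.
rewrite cardsE (card_uniqP _) ?take_uniq ?enum_uniq //.
by rewrite size_take_min -cardE; apply/minn_idPl.
Qed.

Record perron_pair (R : realFieldType) (G : sgraph) (lam : R) (x : G -> R) (u : G) : Prop :=
  PerronPair {
    pp_x01 : forall v, 0 <= x v <= 1;
    pp_xu : x u = 1;
    pp_eig : forall v, lam * x v = \sum_w ind R v w * x w;
    pp_gt0 : 0 < lam }.

(** * The second-moment identity *)

Section Identity.
Variables (R : realFieldType) (G : sgraph) (lam : R) (x : G -> R) (u : G).
Hypothesis P : perron_pair lam x u.

Local Notation N := (nbr u).
Local Notation W := (far u).
Local Notation a := (@ind R G).
Local Notation dg := (@dg R G).
Local Notation me := (me x).
Local Notation mu := (mu x).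
Let x01 := pp_x01 P.

Lemma sum_split_u (F : G -> R) :
  \sum_v F v = F u + \sum_(v in N) F v + \sum_(v in W) F v.
Proof.
rewrite (bigD1 u) //= (bigID (mem N)) /= addrA; congr (_ + _ + _).
  by apply: eq_bigl => v; rewrite !inE; case: eqP => // ->; rewrite adj_irrefl.
by apply: eq_bigl => v; rewrite !inE.
Qed.

Lemma ind_uN v : v \in N -> a u v = 1.
Proof. by rewrite inE => /ind_adj->. Qed.

Lemma ind_uW v : v \in W -> a u v = 0.
Proof. by rewrite inE => /andP[_ /ind_nadj->]. Qed.

Lemma mu_N : mu N = lam.
Proof.
rewrite -[lam]mulr1 -(pp_xu P) (pp_eig P) sum_split_u ind_irrefl mul0r add0r.
rewrite [X in _ + X]big1 ?addr0 => [|v /ind_uW->]; last by rewrite mul0r.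
by apply: eq_bigr => v /ind_uN->; rewrite mul1r.
Qed.

Lemma me_N_u : me N u = lam.
Proof. by rewrite -mu_N; apply: eq_bigr => v /ind_uN->; rewrite mul1r. Qed.

Lemma me_N_le v : me N v <= lam.
Proof. by rewrite -mu_N; apply: me_le_mu. Qed.

Lemma eig_N v : v \in N -> lam * x v = 1 + me N v + me W v.
Proof. by move=> vN; rewrite (pp_eig P) sum_split_u ind_sym ind_uN // (pp_xu P) mulr1. Qed.

Lemma eig_W v : v \in W -> lam * x v = me N v + me W v.
Proof. by move=> vW; rewrite (pp_eig P) sum_split_u ind_sym ind_uW // mul0r add0r. Qed.

Lemma double_edges_split :
  \sum_v \sum_w a v w = 2 * dg N u + \sum_(v in N) dg N v +
    2 * (\sum_(w in W) dg N w) + \sum_(w in W) dg W w.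
Proof.
have row v : \sum_w a v w = a v u + dg N v + dg W v by rewrite sum_split_u.
rewrite sum_split_u row; under eq_bigr => v vN do rewrite row ind_sym ind_uN //.
under [X in _ + X]eq_bigr => v vW do rewrite row ind_sym ind_uW //.
rewrite !big_split /= ind_irrefl.
have -> : dg W u = 0 by apply: big1 => w /ind_uW.
have -> : \sum_(i in N) (1 : R) = dg N u by apply: eq_bigr => v /ind_uN.
rewrite [\sum_(i in W) (0 : R)]big1 // (sum_dg_sym R N W); ring.
Qed.

(* Expanding lam ^ 2 = lam ^ 2 * x u twice along edges and comparing with the
   number of edges. *)
Lemma second_moment :
  2 * lam ^+ 2 - \sum_v \sum_w a v w =
  \sum_(v in N) \sum_(w in N) a v w * (x v + x w - 1)
  - 2 * \sum_(w in W) (1 - x w) * dg N w - \sum_(w in W) dg W w.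
Proof.
rewrite double_edges_split.
have -> : lam ^+ 2 = dg N u + \sum_(v in N) me N v + \sum_(w in W) x w * dg N w.
  rewrite expr2 -{2}mu_N mulr_sumr; under eq_bigr => v vN do rewrite eig_N //.
  rewrite !big_split /= (sum_me_dg _ N W); congr (_ + _ + _).
    by apply: eq_bigr => v /ind_uN.
  by apply: eq_bigr => w _; rewrite mulrC.
have -> : \sum_(v in N) \sum_(w in N) a v w * (x v + x w - 1) =
    2 * \sum_(v in N) me N v - \sum_(v in N) dg N v.
  have sym : \sum_(v in N) \sum_(w in N) a v w * x v = \sum_(v in N) me N v.
    by rewrite sum_ind_exchange.
  rewrite -[2]/(1 + 1) mulrDl mul1r -{1}sym -big_split /= -sumrB.
  apply: eq_bigr => v _; rewrite /me /dg -big_split /= -sumrB.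
  by apply: eq_bigr => w _; ring.
have -> : \sum_(w in W) (1 - x w) * dg N w =
    \sum_(w in W) dg N w - \sum_(w in W) x w * dg N w.
  by rewrite -sumrB; apply: eq_bigr => w _; ring.
ring.
Qed.

End Identity.

(** * First-order structure *)

Section Popular.
Variables (R : realFieldType) (G : sgraph) (k : nat).
Variables (lam : R) (x : G -> R) (u : G).
Hypothesis P : perron_pair lam x u.
Hypothesis k_ge3 : (3 <= k)%N.
Hypothesis wheel_free : subgraph_free (wheel (2 * k + 1)) G.

Local Notation N := (nbr u).
Local Notation W := (far u).
Local Notation a := (@ind R G).
Local Notation dg := (@dg R G).
Local Notation me := (me x).
Local Notation mu := (mu x).
Let x01 := pp_x01 P.
Let x_ge0 := x_ge0 x01.
Let x_le1 := x_le1 x01.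

(** Group the vertices of N by their neighbourhood in [Y]. A class with [k] members and at least [k]
    common neighbours in [Y] would give a K_(k,k) inside N(u), and there are [2 ^ #|Y|] classes. *)
Lemma few_multiply_covered (Y : {set G}) : Y \subset N ->
  (#|[set b in N | (k <= #|Y :&: nbr b|)%N]| <= 2 ^ #|Y| * k)%N.
Proof.
move=> YN; rewrite -sum1_card.
rewrite (partition_big (fun b => Y :&: nbr b) (mem (powerset Y))) /=; last first.
  by move=> b _; rewrite powersetE subsetIl.
rewrite -card_powerset -sum_nat_const; apply: leq_sum => F.
rewrite powersetE => FY; rewrite leqNgt; apply/negP => gt_k; case: wheel_free.
pose Q := [set b in N | Y :&: nbr b == F].
have kQ : (k <= #|Q|)%N.
  apply: leq_trans (ltnW gt_k) _; rewrite sum1_card; apply: subset_leq_card.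
  by apply/subsetP => b; rewrite unfold_in !inE => /andP[/andP[-> _] ->].
have kF : (k <= #|F|)%N.
  move: gt_k; rewrite sum1_card => gt_k.
  have /card_gt0P[b] : (0 < #|fun b => (b \in [set b in N | (k <= #|Y :&: nbr b|)%N])
     && (Y :&: nbr b == F)|)%N by apply: leq_ltn_trans gt_k.
  by rewrite unfold_in !inE => /andP[/andP[_ kb] /eqP<-].
apply: (@wheel_of_biclique _ k u F Q) => //.
- move=> p q pF; rewrite !inE => /andP[_ /eqP FE].
  by move: pF; rewrite -FE !inE adj_sym => /andP[].
- by move=> p /(subsetP FY)/(subsetP YN); rewrite inE.
- by move=> q; rewrite !inE => /andP[].
Qed.

(** Double counting: a vertex of N with at most k-1 neighbours in [Y] contributes at most k-1 times
    its weight, and the weights of N add up to [lam]; the few others contribute at most [#|Y|]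
    each. *)
Lemma sum_me_N (Y : {set G}) : Y \subset N ->
  \sum_(y in Y) me N y <= (k%:R - 1) * lam + (#|Y| * (2 ^ #|Y| * k))%:R.
Proof.
move=> YN; rewrite sum_me_dg.
pose bad := [set b in N | (k <= #|Y :&: nbr b|)%N].
apply: le_trans (_ : \sum_(b in N)
    ((k%:R - 1) * x b + if b \in bad then #|Y|%:R else 0) <= _).
  apply: ler_sum => b bN; rewrite inE bN /=; case: ifP => kb.
    have := dg_le_card R Y b; have := x_le1 b; have := x_ge0 b.
    have := dg_ge0 R Y b.
    have Y1 : (1 : R) <= #|Y|%:R.
      rewrite ler1n; apply: leq_trans (subset_leq_card (subsetIl Y (nbr b))).
      by apply: leq_trans kb; apply: leq_trans k_ge3.
    have k1 : (1 : R) <= k%:R by rewrite ler1n; apply: leq_trans k_ge3.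
    nra.
  rewrite addr0 ler_wpM2r // dg_card lerBrDr.
  have -> : #|Y :&: nbr b|%:R + 1 = (#|Y :&: nbr b|.+1)%:R :> R by rewrite natr1.
  by rewrite ler_nat ltnNge kb.
rewrite big_split /= -mulr_sumr -/(mu N) (mu_N P) lerD2l -big_mkcondr /=.
rewrite (eq_bigl (mem bad)) => [|b]; last by rewrite !inE; case: adj.
rewrite sumr_const -mulrnA ler_nat leq_mul2l few_multiply_covered //.
by rewrite orbT.
Qed.

Lemma popular_card (d : R) M : 0 < d -> 2 * k%:R <= d * M%:R ->
  (M * (2 ^ M * k))%:R <= lam -> (#|[set y in N | (d * lam <= me N y)%R]| < M)%N.
Proof.
(* The error term of [sum_me_N] is exponential in the size of the set, so it is applied to exactly
   [M] of the vertices. *)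
move=> d_gt0 dM lam_large; rewrite ltnNge; apply/negP => /set_of_card[Y YS YM].
have YN : Y \subset N.
  by apply: subset_trans YS _; apply/subsetP => y; rewrite inE => /andP[].
have := sum_me_N YN; rewrite YM => le_sum.
have ge_sum : M%:R * (d * lam) <= \sum_(y in Y) me N y.
  rewrite -YM mulr_natl -sumr_const; apply: ler_sum => y /(subsetP YS).
  by rewrite inE => /andP[].
have k1 : (1 : R) <= k%:R by rewrite ler1n; apply: leq_trans k_ge3.
have := pp_gt0 P; nra.
Qed.

(** Termwise this is (1 - x v)(1 - x w) >= 0. *)
Lemma sum_NN_le :
  \sum_(v in N) \sum_(w in N) a v w * (x v + x w - 1) <= \sum_(v in N) x v * me N v.
Proof.
apply: ler_sum => v _; rewrite mulr_sumr; apply: ler_sum => w _.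
rewrite mulrCA ler_wpM2l ?ind_ge0 //.
by have := x_le1 v; have := x_le1 w; nra.
Qed.

(** The slack says m - C <= lam^2 - (k-1) lam; it is doubled because the double sum counts each edge
    twice. *)
Variable C : R.
Hypothesis slack :
  \sum_v \sum_w a v w - 2 * C <= 2 * (lam ^+ 2 - (k%:R - 1) * lam).

Lemma slack_NN :
  2 * (k%:R - 1) * lam - 2 * C + 2 * \sum_(w in W) (1 - x w) * dg N w
    + \sum_(w in W) dg W w <=
  \sum_(v in N) \sum_(w in N) a v w * (x v + x w - 1).
Proof. by have := second_moment P; have := slack; lra. Qed.

Lemma far_cost_ge0 w : 0 <= (1 - x w) * dg N w.
Proof. by rewrite mulr_ge0 ?dg_ge0 // subr_ge0. Qed.

Section FirstOrder.
Variables (d : R) (M : nat).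
Hypothesis d01 : 0 < d <= 1.
Hypothesis dM : 2 * k%:R <= d ^+ 2 * M%:R.
Hypothesis lam_large : (M * (2 ^ M * k))%:R + 2 * `|C| <= d ^+ 2 * lam ^+ 2.
Hypothesis lam_large' : (M * (2 ^ M * k))%:R <= lam.

Let lam_gt0 := pp_gt0 P.
Let k_ge1 : (1 : R) <= k%:R.
Proof. by rewrite ler1n; apply: leq_trans k_ge3. Qed.

(** Boundedly many vertices of N see at least [d ^+ 2 * lam] of its mass, and they contribute
    O(lam); the rest contribute at most [d ^+ 2 * lam] per unit of mass. The square leaves a factor
    [d] to spend on the thresholds in [twins]. *)
Lemma far_cost_small :
  2 * \sum_(w in W) (1 - x w) * dg N w + \sum_(w in W) dg W w <=
  2 * d ^+ 2 * lam ^+ 2.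
Proof.
pose Y := [set y in N | d ^+ 2 * lam <= me N y].
have d2 : 0 < d ^+ 2 by rewrite exprn_gt0 //; case/andP: d01.
have YM : (#|Y| < M)%N by apply: popular_card.
have YN : Y \subset N by apply/subsetP => y; rewrite inE => /andP[].
have le_NN : \sum_(v in N) x v * me N v <=
    (k%:R - 1) * lam + (M * (2 ^ M * k))%:R + d ^+ 2 * lam ^+ 2.
  rewrite (sum_setD _ YN); apply: lerD.
    apply: le_trans (_ : \sum_(y in Y) me N y <= _).
      by apply: ler_sum => y _; rewrite ler_piMl ?me_ge0.
    apply: le_trans (sum_me_N YN) _; rewrite lerD2l ler_nat.
    by apply: leq_mul; rewrite ?leq_mul2r ?leq_pexp2l ?orbT // ltnW.
  have -> : d ^+ 2 * lam ^+ 2 = \sum_(v in N) x v * (d ^+ 2 * lam).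
    by rewrite -mulr_suml -/(mu N) (mu_N P); ring.
  apply: le_trans (_ : \sum_(i in N :\: Y) x i * (d ^+ 2 * lam) <= _).
    apply: ler_sum => y; rewrite !inE negb_and => /andP[+ uy]; rewrite uy /= -ltNge.
    by move/ltW => le_y; rewrite ler_wpM2l.
  apply: sum_subset (subsetDl _ _) _ => v _.
  by rewrite mulr_ge0 ?x_ge0 // mulr_ge0 ?ltW.
have := sum_NN_le; have := slack_NN; have := ler_norm C; have := lam_large.
have : 0 <= (k%:R - 1) * lam by rewrite mulr_ge0 ?subr_ge0 // ltW.
by lra.
Qed.

Let far_cost1 : \sum_(w in W) (1 - x w) * dg N w <= d ^+ 2 * lam ^+ 2.
Proof.
have := far_cost_small.
have : 0 <= \sum_(w in W) dg W w by apply: sumr_ge0 => w _; exact: dg_ge0.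
by lra.
Qed.

Let far_cost2 : \sum_(w in W) dg W w <= 2 * d ^+ 2 * lam ^+ 2.
Proof.
have := far_cost_small.
have : 0 <= \sum_(w in W) (1 - x w) * dg N w by apply: sumr_ge0 => w _; exact: far_cost_ge0.
by lra.
Qed.

(** A large entry together with few neighbours in W forces nearly all of the mass of N into the
    neighbourhood, as for [u] itself. *)
Definition twins := [set w in W | (1 - d <= x w) && (dg W w <= d * lam)].

Lemma twins_far : twins \subset W.
Proof. by apply/subsetP => w; rewrite inE => /andP[]. Qed.

Lemma me_N_twin w : w \in twins -> (1 - 2 * d) * lam <= me N w.
Proof.
rewrite inE => /and3P[wW xw dw]; have := eig_W P wW.
have := me_le_dg x01 W w; have : (1 - d) * lam <= x w * lam.
  by rewrite ler_wpM2r // ltW.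
by move: dw; lra.
Qed.

(** Two Markov estimates. Vertices with many neighbours in W are few, by the edge count of W. Where
    the entry is below [1 - d], the cost bounds the degrees into N, and the eigenvalue equation
    turns degrees into mass. *)
Lemma mu_far_nontwins : mu (W :\: twins) <= 5 * d * lam.
Proof.
have [d_gt0 d_le1] := andP d01.
pose W1 := [set w in W | d * lam < dg W w].
pose W2 := [set w in W | x w < 1 - d].
have sub : W :\: twins \subset W1 :|: W2.
  apply/subsetP => w; rewrite !inE => /andP[twin_w /andP[wu uw]].
  by move: twin_w; rewrite wu uw /= negb_and -!ltNge => /orP[->|->]; rewrite ?orbT.
have mu1 : mu W1 <= 2 * d * lam.
  have W1W : W1 \subset W by apply/subsetP => w; rewrite inE => /andP[].
  have : #|W1|%:R * (d * lam) <= 2 * d ^+ 2 * lam ^+ 2.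
    apply: le_trans far_cost2; apply: le_trans (_ : \sum_(w in W1) dg W w <= _).
      rewrite mulr_natl -sumr_const; apply: ler_sum => w.
      by rewrite inE => /andP[_ /ltW].
    by apply: sum_subset => // w _; exact: dg_ge0.
  have -> : 2 * d ^+ 2 * lam ^+ 2 = (2 * d * lam) * (d * lam) by ring.
  rewrite ler_pM2r ?mulr_gt0 // => /(le_trans _); apply; exact: mu_le_card.
have mu2 : mu W2 <= 3 * d * lam.
  have W2W : W2 \subset W by apply/subsetP => w; rewrite inE => /andP[].
  have dg2 : \sum_(w in W2) dg N w <= d * lam ^+ 2.
    rewrite -(ler_pM2l d_gt0) mulr_sumr mulrA -expr2; apply: le_trans far_cost1.
    apply: le_trans (_ : \sum_(w in W2) (1 - x w) * dg N w <= _).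
      apply: ler_sum => w; rewrite inE => /andP[_ xw].
      by apply: ler_wpM2r; [exact: dg_ge0 | move: xw; lra].
    by apply: sum_subset => // w _; exact: far_cost_ge0.
  have : lam * mu W2 <= \sum_(w in W2) dg N w + \sum_(w in W2) dg W w.
    rewrite mulr_sumr -big_split; apply: ler_sum => w /(subsetP W2W)/(eig_W P)->.
    by apply: lerD; apply: me_le_dg.
  have : \sum_(w in W2) dg W w <= \sum_(w in W) dg W w.
    by apply: sum_subset => // w _; exact: dg_ge0.
  have := far_cost2; have : d ^+ 2 * lam ^+ 2 <= d * lam ^+ 2.
    by rewrite expr2 -mulrA ler_piMl // mulr_ge0 ?sqr_ge0 // ltW.
  move=> H1 H2 H3 H4.
  have : lam * mu W2 <= lam * (3 * d * lam) by move: dg2; lra.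
  by rewrite ler_pM2l.
apply: le_trans (_ : mu (W1 :|: W2) <= _); first exact: mu_subset.
apply: le_trans (_ : mu W1 + mu W2 <= _); last by lra.
have -> : W1 :|: W2 = W1 :|: (W2 :\: W1).
  by apply/setP => w; rewrite !in_setU in_setD; case: (w \in W1).
rewrite /mu sum_setU; last by rewrite -setI_eq0 setIDA setIC -setIDA setDv setI0.
by rewrite lerD2l; apply: mu_subset => //; apply: subsetDl.
Qed.

End FirstOrder.
End Popular.

(** * Few twins *)

(** The hub [c] and [k] of its neighbours in [F] miss so little of [A] that their common neighbours
    there have mass at least [k], hence number at least [k], and complete a biclique around [c]. *)
Lemma wheel_of_mass (R : realFieldType) (G : sgraph) k (y : G -> R) (c : G)
    (A F : {set G}) (e1 e2 : R) :
  (forall v, 0 <= y v <= 1) -> (k <= #|F|)%N -> F \subset nbr c ->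
  mu y A - me y A c <= e1 -> {in F, forall z, mu y A - me y A z <= e2} ->
  k%:R <= mu y A - e1 - k%:R * e2 -> has_subgraph (wheel (2 * k + 1)) G.
Proof.
move=> y01 kF Fc Ac AF k_le; have [F' F'F F'k] := set_of_card kF.
have cF' : c \notin F'.
  by apply/negP => /(subsetP F'F)/(subsetP Fc); rewrite inE adj_irrefl.
apply: (@wheel_of_biclique _ k c F' [set b in A | [forall z in c |: F', adj z b]]).
- by rewrite F'k.
- apply: (common_card y01); apply: le_trans k_le _.
  rewrite big_setU1 //= -addrA -opprD lerD2l lerN2 lerD // -F'k mulr_natl.
  by rewrite -sumr_const; apply: ler_sum => z /(subsetP F'F)/AF.
- move=> p q pF; rewrite !inE => /andP[_ /forallP/(_ p)].
  by rewrite !inE pF orbT.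
- by move=> p /(subsetP F'F)/(subsetP Fc); rewrite inE.
- by move=> q; rewrite !inE => /andP[_ /forallP/(_ c)]; rewrite !inE eqxx.
Qed.

Lemma wheel_of_count (R : realFieldType) (G : sgraph) k (c : G) (A F : {set G}) (e1 e2 : R) :
  (k <= #|F|)%N -> F \subset nbr c ->
  #|A|%:R - dg R A c <= e1 -> {in F, forall z, #|A|%:R - dg R A z <= e2} ->
  k%:R <= #|A|%:R - e1 - k%:R * e2 -> has_subgraph (wheel (2 * k + 1)) G.
Proof.
have mu1 : mu (fun _ => 1 : R) A = #|A|%:R by exact: sum1_mu.
have me1 v : me (fun _ => 1 : R) A v = dg R A v by apply: eq_bigr => w _; rewrite mulr1.
rewrite -mu1 -me1 => kF Fc Ac AF; apply: (wheel_of_mass _ kF Fc Ac).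
  by move=> v; rewrite ler01 lexx.
by move=> z zF; rewrite me1; exact: AF.
Qed.

Section Balanced.
Variables (R : realFieldType) (G : sgraph) (k : nat).
Variables (lam : R) (x : G -> R) (u : G).
Hypothesis P : perron_pair lam x u.
Hypothesis k_ge3 : (3 <= k)%N.
Hypothesis wheel_free : subgraph_free (wheel (2 * k + 1)) G.
Variable C : R.
Hypothesis slack :
  \sum_v \sum_w @ind R G v w - 2 * C <= 2 * (lam ^+ 2 - (k%:R - 1) * lam).

Local Notation N := (nbr u).
Local Notation W := (far u).
Local Notation a := (@ind R G).
Local Notation dg := (@dg R G).
Local Notation me := (me x).
Local Notation mu := (mu x).
Let x01 := pp_x01 P.
Let x_ge0 := x_ge0 x01.
Let x_le1 := x_le1 x01.
Let lam_gt0 := pp_gt0 P.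
Let k_ge1 : (3 : R) <= k%:R.
Proof. by rewrite ler_nat. Qed.

Variables (d : R) (T : {set G}).
Hypothesis T_far : T \subset W.
Hypothesis T_me : {in T, forall w, (1 - 2 * d) * lam <= me N w}.
Hypothesis T_x : {in T, forall w, 1 - d <= x w}.
Hypothesis T_rest : mu (W :\: T) <= 5 * d * lam.

(* Eventually t0 = 1/(24k), tau = 1/(16k^2), c = tau t0/2, d = c tau/4 and lam is large. *)
Variables (t0 tau c : R) (M : nat).
Let s : R := #|T|%:R.
Hypothesis s_large : t0 * lam <= s.
Hypothesis d_pos : 0 < d.
Hypothesis tau_pos : 0 < tau.
Hypothesis c_pos : 0 < c.
Hypothesis d_k : 8 * (k%:R + 1) * d <= 1.
Hypothesis tau_k : 16 * (k%:R + 1) * k%:R * tau <= 3.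
Hypothesis d_tau : d <= 2 * k%:R * tau.
Hypothesis d_c_tau : 4 * d <= c * tau.
Hypothesis c_tau_t0 : 2 * c <= tau * t0.
Hypothesis c_t0 : 16 * k%:R * c <= t0.
Hypothesis d_t0 : 32 * k%:R ^+ 2 * d <= t0.
Hypothesis h_k : 2 * k%:R * (2 * d + 2 * k%:R * tau) <= 2^-1.
Hypothesis cM : 2 * k%:R <= c * M%:R.
Hypothesis M_lam : (M * (2 ^ M * k))%:R <= lam.
Hypothesis k_lam : 2 * (k%:R + 1) <= lam.
Hypothesis d_lam : 1 <= d * lam.
Hypothesis c_lam : 2 * k%:R <= c * lam.
Hypothesis tau_s : 1 <= tau * s.
Hypothesis C_lam : 16 * (C + (M * (2 ^ M * k))%:R) < t0 * lam.
Hypothesis d_c : 6 * d <= c.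

Let N_miss z : z \in T -> mu N - me N z <= 2 * d * lam.
Proof. by move=> /T_me; rewrite (mu_N P); lra. Qed.

Lemma twin_degree w : w \in T -> (#|T :&: nbr w| < k)%N.
Proof.
move=> wT; rewrite ltnNge; apply/negP => k_le; case: wheel_free.
apply: (@wheel_of_mass R G k x w N (T :&: nbr w) (2 * d * lam) (2 * d * lam)) => //.
- exact: subsetIr.
- exact: N_miss.
- by move=> z /setIP[/N_miss].
- rewrite (mu_N P); have := k_lam; have := d_k; have := lam_gt0.
  have : 8 * (k%:R + 1) * d * lam <= lam by rewrite ler_piMl // ltW.
  by lra.
Qed.

Let sum_TT_le : \sum_(w in T) dg T w <= (k%:R - 1) * s.
Proof.
rewrite mulr_natr -sumr_const; apply: ler_sum => w /twin_degree.
by rewrite dg_card lerBrDr natr1 ler_nat.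
Qed.

Definition miss b : R := s - dg T b.

Lemma miss_ge0 b : 0 <= miss b.
Proof. by rewrite subr_ge0 dg_le_card. Qed.

Lemma sum_miss :
  \sum_(b in N) x b * miss b = \sum_(w in T) (lam - me N w).
Proof.
rewrite sumrB (sum_me_dg x T N) sumr_const -mulr_natr -/s -(mu_N P) mulr_suml -sumrB.
by apply: eq_bigr => b _; rewrite /miss; ring.
Qed.

Lemma sum_miss_le : \sum_(b in N) x b * miss b <= 2 * d * lam * s.
Proof.
rewrite sum_miss mulr_natr -sumr_const; apply: ler_sum => w /N_miss.
by rewrite (mu_N P).
Qed.

(** Weigh the edges between [T] and N: every twin accounts for at least (1-2d) lam, while a vertex
    of N sees weight at most [lam] in [T], because its own entry is at most 1. *)
Lemma card_twins_le : (1 - d) * (1 - 2 * d) * s <= lam.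
Proof.
have d1 : 0 <= 1 - d by have := d_k; have := k_ge1; have := d_pos; nra.
rewrite -(ler_pM2r lam_gt0).
apply: le_trans (_ : (1 - d) * \sum_(w in T) me N w <= _).
  rewrite -!mulrA ler_wpM2l // mulrCA [s * _]mulr_natl -sumr_const.
  by apply: ler_sum => w /T_me.
rewrite sum_me_dg -{2}(mu_N P) !mulr_sumr; apply: ler_sum => b bN.
rewrite mulrA ler_wpM2r //.
apply: le_trans (_ : me T b <= _).
  rewrite mulr_sumr; apply: ler_sum => w /T_x xw; rewrite mulrC.
  by rewrite ler_wpM2l ?ind_ge0.
have := eig_N P bN; have : me T b <= me W b by exact: me_subset.
have : lam * x b <= lam by rewrite ler_piMr // ltW.
by have := me_ge0 x01 N b; lra.
Qed.

Definition typical := [set b in N | miss b <= tau * s].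

Lemma typical_N : typical \subset N.
Proof. by apply/subsetP => b; rewrite inE => /andP[]. Qed.

Let s_gt0 : 0 < s.
Proof. by have := tau_s; have := tau_pos; nra. Qed.

Lemma mu_atypical : tau * mu (N :\: typical) <= 2 * d * lam.
Proof.
rewrite -(ler_pM2r s_gt0); apply: le_trans sum_miss_le.
rewrite mulrAC /mu mulr_sumr; apply: le_trans (_ : \sum_(b in N :\: typical) x b * miss b <= _).
  apply: ler_sum => b; rewrite !inE negb_and => /andP[+ ub]; rewrite ub /= -ltNge.
  by move/ltW => ?; rewrite mulrC ler_wpM2l.
by apply: sum_subset (subsetDl _ _) _ => b _; rewrite mulr_ge0 ?miss_ge0 ?x_ge0.
Qed.

Lemma typical_degree b : b \in typical -> (#|typical :&: nbr b| < k)%N.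
Proof.
move=> bt; rewrite ltnNge; apply/negP => k_le; case: wheel_free.
have typ_miss z : z \in typical -> #|T|%:R - dg T z <= tau * s.
  by rewrite inE => /andP[].
apply: (@wheel_of_count R G k b T (typical :&: nbr b) (tau * s) (tau * s)) => //.
- exact: subsetIr.
- exact: typ_miss.
- by move=> z /setIP[/typ_miss].
- rewrite -/s; have := tau_s; have := tau_k; have := k_ge1; have := s_gt0.
  move=> h1 h2 h3 h4; have : 16 * (k%:R + 1) * k%:R * tau * s <= 3 * s by rewrite ler_pM2r.
  have : k%:R * 1 <= k%:R * (tau * s) by rewrite ler_wpM2l // ltW; lra.
  have : 0 <= tau * s by lra.
  have : 3 * ((k%:R + 1) * (tau * s)) <= k%:R * ((k%:R + 1) * (tau * s)).
    by rewrite ler_wpM2r // mulr_ge0; lra.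
  by lra.
Qed.

Definition popular := [set y in N | c * lam <= me N y].

Lemma popular_N : popular \subset N.
Proof. by apply/subsetP => b; rewrite inE => /andP[]. Qed.

Lemma popular_few : (#|popular| < M)%N.
Proof. exact: (popular_card P k_ge3 wheel_free c_pos cM M_lam). Qed.

(** A popular vertex has [k] typical neighbours, each adjacent to nearly all of [T]; if it saw more
    than a small share of [T], it would be the hub of a wheel. Popular vertices therefore miss
    almost all twins and pay for it in [sum_miss]. *)
Lemma popular_dg_T y : y \in popular -> dg T y <= 2 * k%:R * (tau * s).
Proof.
rewrite inE => /andP[yN y_pop]; rewrite leNgt; apply/negP => dg_gt; case: wheel_free.
apply: (@wheel_of_count R G k y (T :&: nbr y) (typical :&: nbr y) 0 (tau * s)) => //.
- have : me N y <= me typical y + mu (N :\: typical).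
    rewrite {1}/me (sum_setD _ typical_N) lerD2l; apply: me_le_mu => //.
  have : me typical y <= dg typical y by exact: me_le_dg.
  rewrite dg_card -(ler_nat R).
  have : tau * (2 * mu (N :\: typical)) <= tau * (c * lam).
    have := mu_atypical; have : 4 * d * lam <= c * tau * lam by rewrite ler_pM2r.
    by lra.
  by rewrite ler_pM2l //; have := c_lam; lra.
- exact: subsetIr.
- by rewrite dg_card -setIA setIid subrr.
- move=> z /setIP[]; rewrite inE => /andP[zN z_miss] _; apply: le_trans z_miss.
  rewrite /miss /s !dg_card.
  have -> : T :&: nbr y :&: nbr z = (T :&: nbr z) :&: nbr y by rewrite setIAC.
  rewrite lerBlDr addrAC lerBrDr -!natrD ler_nat.
  rewrite -(cardsID (nbr y) T) -(cardsID (nbr y) (T :&: nbr z)).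
  have : (#|(T :&: nbr z) :\: nbr y| <= #|T :\: nbr y|)%N.
    by apply/subset_leq_card/setSD/subsetIl.
  by clear; lia.
- rewrite -dg_card subr0; have := tau_s; have := k_ge1; have := dg_gt; move=> h1 h2 h3.
  have : k%:R * 1 <= k%:R * (tau * s) by rewrite ler_wpM2l //; lra.
  by lra.
Qed.

(** Outside [T] an unpopular vertex sees little mass, so its entry is at most about s / lam. Hence a
    graph of degree n on such vertices contributes about n s, the same scale as degree n inside
    [T]. *)
Lemma unpopular_x b : b \in N :\: popular -> lam * x b <= s + 2 * c * lam.
Proof.
rewrite !inE negb_and => /andP[+ ub]; rewrite ub /= -ltNge => b_unpop.
have bN : b \in N by rewrite inE.
have := eig_N P bN; have TW : me W b <= me T b + mu (W :\: T).
  by rewrite {1}/me (sum_setD _ T_far) lerD2l; apply: me_le_mu.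
have : me T b <= s by apply: le_trans (me_le_dg x01 _ _) (dg_le_card _ _ _).
have := T_rest; have := d_lam; have : 6 * d * lam <= c * lam by rewrite ler_pM2r.
by move: b_unpop TW; lra.
Qed.

Definition common w := [set b in N | [forall z in w |: (T :&: nbr w), adj z b]].

Lemma mu_noncommon w : w \in T -> mu (N :\: common w) <= 2 * k%:R * d * lam.
Proof.
move=> wT; have common_N : common w \subset N by apply/subsetP => b; rewrite inE => /andP[].
have := common_mass x01 N (w |: (T :&: nbr w)); rewrite -/(common w).
rewrite {1}/mu (sum_setD x common_N) -/(mu _) -/(mu _).
suff : \sum_(z in w |: (T :&: nbr w)) (mu N - me N z) <= 2 * k%:R * d * lam by lra.
have -> : 2 * k%:R * d * lam = (2 * d * lam) * k%:R by ring.
apply: le_trans (_ : (2 * d * lam) * #|w |: (T :&: nbr w)|%:R <= _).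
  rewrite mulr_natr -sumr_const; apply: ler_sum => z.
  by rewrite !inE => /predU1P[->|/andP[zT _]]; apply: N_miss.
rewrite ler_wpM2l ?mulr_ge0 ?(ltW d_pos) ?(ltW lam_gt0) //.
rewrite ler_nat cardsU1 !inE adj_irrefl andbF add1n.
exact: twin_degree.
Qed.

(** Two neighbours of [b] in [common w] would give a path with middle [b], to which [wheel_of_path3]
    applies with hub [w] and with the k-1 neighbours of [w] in [T] as [P]. *)
Lemma common_matching w b : w \in T -> #|T :&: nbr w| = k.-1 -> b \in common w ->
  (#|common w :&: nbr b| <= 1)%N.
Proof.
move=> wT degw bZ; rewrite leqNgt; apply/negP => /card_gt1P[b1 [b3 [h1 h3 b13]]].
have /setIP[b1Z bb1] := h1; have /setIP[b3Z bb3] := h3.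
case: wheel_free.
have Zadj z y : z \in common w -> y \in w |: (T :&: nbr w) -> adj y z.
  by rewrite inE => /andP[_ /forallP/(_ y)/implyP].
have bigZ : (k + 1 <= #|common w|)%N.
  rewrite -(ler_nat R); apply: le_trans (mu_le_card x01 _).
  have := mu_noncommon wT; have common_N : common w \subset N.
    by apply/subsetP => z; rewrite inE => /andP[].
  have := mu_N P; rewrite {1}/mu (sum_setD x common_N) -/(mu _) -/(mu _) natrD.
  have := k_lam; have : 8 * (k%:R + 1) * d * lam <= lam by rewrite ler_piMl // ltW.
  have : 0 <= k%:R * d * lam by rewrite !mulr_ge0 // ltW.
  have : 0 <= d * lam by rewrite !mulr_ge0 // ltW.
  by have := lam_gt0; lra.
have Tfar z : z \in T -> z \in N -> False.
  by move=> /(subsetP T_far); rewrite !inE => /andP[_ /negP].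
have ZN z : z \in common w -> z \in N by rewrite inE => /andP[].
apply: (@wheel_of_path3 G k w b1 b b3 (T :&: nbr w) (common w :\: [set b1; b; b3])) => //.
- by rewrite degw.
(* There are at least [k + 1] common neighbours, so deleting the path leaves the required k-2. *)
- have : (#|common w :&: [set b1; b; b3]| <= 3)%N.
    apply: leq_trans (subset_leq_card (subsetIr _ _)) _.
    by rewrite cardsU; apply: leq_trans (leq_subr _ _) _; rewrite cards2 cards1; case: (_ != _).
  by have := cardsID [set b1; b; b3] (common w); move: bigZ; clear; lia.
- by rewrite adj_sym; move: bb1; rewrite inE.
- by move: bb3; rewrite inE.
- by rewrite !inE eqxx.
- by rewrite !inE eqxx orbT.
- by rewrite !inE eqxx !orbT.
- by move=> p pP; split; apply: Zadj => //; rewrite in_setU1 pP orbT.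
- by apply/negP => /setIP[/Tfar] /(_ (ZN _ bZ)).
- by move=> p q pP /setDP[qZ _]; apply: Zadj => //; rewrite in_setU1 pP orbT.
- by move=> p /setIP[_]; rewrite inE.
- by move=> q /setDP[qZ _]; apply: Zadj => //; rewrite !inE eqxx.
- by apply: Zadj => //; rewrite !inE eqxx.
- by apply: Zadj => //; rewrite !inE eqxx.
- by apply: Zadj => //; rewrite !inE eqxx.
Qed.

Let typ := typical :\: popular.

Lemma typ_x b : b \in typ -> x b <= (s + 2 * c * lam) / lam.
Proof.
move=> /setDP[bt bp]; rewrite ler_pdivlMr // mulrC; apply: unpopular_x.
by apply/setDP; split; first exact: (subsetP typical_N).
Qed.

Let mu_sub_N (A : {set G}) : A \subset N -> mu A <= lam.
Proof. by move=> AN; rewrite -(mu_N P); apply: mu_subset. Qed.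

Let typ_N : typ \subset N.
Proof. exact: subset_trans (subsetDl _ _) typical_N. Qed.

Let sum_typ_bound (A : {set G}) n : A \subset typ ->
  {in A, forall b, (#|A :&: nbr b| <= n)%N} ->
  \sum_(b in A) x b * me A b <= n%:R * (s + 2 * c * lam).
Proof.
move=> At A_deg; set B := s + 2 * c * lam.
have B_ge0 : 0 <= B.
  by rewrite addr_ge0 ?(ltW s_gt0) // mulr_ge0 ?(ltW lam_gt0) // mulr_ge0 ?(ltW c_pos).
apply: le_trans (_ : \sum_(b in A) x b * (n%:R * (B / lam)) <= _).
  apply: ler_sum => b bA; rewrite ler_wpM2l //.
  apply: le_trans (_ : B / lam * dg A b <= _).
    by apply: me_le_dg_bound => z zA; apply: typ_x; apply: (subsetP At).
  rewrite mulrC ler_wpM2r ?divr_ge0 ?(ltW lam_gt0) // dg_card ler_nat.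
  exact: A_deg.
rewrite -mulr_suml mulrCA ler_wpM2l // mulrA ler_pdivrMr // mulrC ler_wpM2l //.
by apply/mu_sub_N/(subset_trans At).
Qed.

(* A vertex of T with k - 1 neighbours in T forces its common neighbourhood to
   induce a matching, so the two sides cannot both have degree k - 1. *)
Lemma degree_tradeoff : exists d1 d2 : R,
  [/\ 0 <= d2 <= k%:R, d1 + d2 <= 2 * k%:R - 3, \sum_(w in T) dg T w <= d1 * s &
    \sum_(b in typ) x b * me typ b <=
      d2 * (s + 2 * c * lam) + 4 * k%:R ^+ 2 * d * lam].
Proof.
have deg_typ b : b \in typ -> (#|typ :&: nbr b| <= k.-1)%N.
  move=> /setDP[bt _]; rewrite -ltnS prednK; last by apply: leq_trans k_ge3.
  apply: leq_ltn_trans (typical_degree bt); apply: subset_leq_card.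
  by apply: setSI; apply: subsetDl.
have k1E : (k.-1)%:R = k%:R - 1 :> R by rewrite -subn1 natrB //; apply: leq_trans k_ge3.
have [/existsP[w /andP[wT /eqP degw]]|no_full] :=
    boolP [exists w, (w \in T) && (#|T :&: nbr w| == k.-1)%N].
  (* The twins may have degree k-1 while the typical side is nearly a matching; the sum k is at most
     2k-3 because k >= 3. *)
  exists (k%:R - 1), 1; split.
  - by rewrite ler01 /=; have := k_ge1; lra.
  - by have := k_ge1; lra.
  - exact: sum_TT_le.
  rewrite mul1r; set A := typ :&: common w.
  have At : A \subset typ by exact: subsetIl.
  have AE : typ :\: A \subset N :\: common w.
    apply/subsetP => b /setDP[bt]; rewrite inE bt /= => bc.
    by apply/setDP; split=> //; apply: (subsetP typ_N).
  have sA : \sum_(b in A) x b * me A b <= 1 * (s + 2 * c * lam).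
    apply: (@sum_typ_bound A 1) => // b /setIP[_ bc].
    apply: leq_trans (common_matching wT degw bc); apply: subset_leq_card.
    by apply: setSI; apply: subsetIr.
  (* Outside [common w] only mass 2 k d lam remains; it is responsible for the last term of the
     bound. *)
  have sB : \sum_(b in typ :\: A) x b * me typ b <= (k%:R - 1) * (2 * k%:R * d * lam).
    apply: le_trans (_ : \sum_(b in typ :\: A) x b * (k%:R - 1) <= _).
      apply: ler_sum => b /setDP[bt _]; rewrite ler_wpM2l //.
      by apply: le_trans (me_le_dg x01 _ _) _; rewrite dg_card -k1E ler_nat deg_typ.
    rewrite -mulr_suml mulrC ler_wpM2l //; first by have := k_ge1; lra.
    by apply: le_trans (mu_noncommon wT); apply: mu_subset.
  have -> : \sum_(b in typ) x b * me typ b =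
     \sum_(b in A) x b * me A b + \sum_(b in A) x b * me (typ :\: A) b
     + \sum_(b in typ :\: A) x b * me typ b.
    rewrite (sum_setD _ At) -big_split /=; congr (_ + _); apply: eq_bigr => b _.
    by rewrite -mulrDr /me (sum_setD _ At).
  have : \sum_(b in A) x b * me (typ :\: A) b <= \sum_(b in typ :\: A) x b * me typ b.
    have -> : \sum_(b in A) x b * me (typ :\: A) b = \sum_(b in typ :\: A) x b * me A b.
      rewrite /me; under eq_bigr => b _ do rewrite mulr_sumr.
      rewrite exchange_big; apply: eq_bigr => b _; rewrite mulr_sumr.
      by apply: eq_bigr => z _; rewrite ind_sym; ring.
    by apply: ler_sum => b _; rewrite ler_wpM2l //; apply: me_subset.
  have : 0 <= k%:R * d * lam by rewrite !mulr_ge0 // ltW.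
  by move: sA sB; rewrite mul1r expr2; lra.
(* No twin has degree k-1 in [T], so here [T] itself gives up the unit. *)
exists (k%:R - 2), (k%:R - 1); split.
- by have := k_ge1; lra.
- by lra.
- rewrite mulr_natr -sumr_const; apply: ler_sum => w wT.
  rewrite dg_card lerBrDr -natrD ler_nat.
  have := twin_degree wT; rewrite negb_exists in no_full.
  have := forallP no_full w; rewrite wT /= => /eqP; move: k_ge3; clear; lia.
- rewrite -k1E; have := @sum_typ_bound typ k.-1 (subxx _) deg_typ.
  have : 0 <= k%:R ^+ 2 * d * lam by rewrite !mulr_ge0 ?sqr_ge0 // ltW.
  by lra.
Qed.

Let form_sym (A B : {set G}) :
  \sum_(b in A) x b * me B b = \sum_(b in B) x b * me A b.
Proof.
rewrite /me; under eq_bigr => b _ do rewrite mulr_sumr.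
rewrite exchange_big; apply: eq_bigr => b _; rewrite mulr_sumr.
by apply: eq_bigr => z _; rewrite ind_sym; ring.
Qed.

Let form_split (A B D : {set G}) : B \subset A ->
  \sum_(b in D) x b * me A b =
  \sum_(b in D) x b * me B b + \sum_(b in D) x b * me (A :\: B) b.
Proof.
move=> BA; rewrite -big_split /=; apply: eq_bigr => b _.
by rewrite -mulrDr /me (sum_setD _ BA).
Qed.

Let form_mono (A B D : {set G}) : A \subset B ->
  \sum_(b in D) x b * me A b <= \sum_(b in D) x b * me B b.
Proof. by move=> AB; apply: ler_sum => b _; rewrite ler_wpM2l //; apply: me_subset. Qed.

Let rare := (N :\: popular) :\: typ.

Lemma sum_N_split :
  \sum_(v in N) x v * me N v <=
  2 * \sum_(y in popular) x y * me N y + 2 * \sum_(z in rare) x z * me N z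
  + \sum_(b in typ) x b * me typ b.
Proof.
have tN : typ \subset N :\: popular by apply: setSD; exact: typical_N.
rewrite (sum_setD _ popular_N) (sum_setD _ tN) -/rare.
rewrite (form_split typ popular_N) (form_split typ tN) -/rare.
have := form_sym typ popular; have := form_sym typ rare.
have := form_mono popular typ_N.
have : rare \subset N by apply: subset_trans (subsetDl _ _) (subsetDl _ _).
move/(form_mono typ); have := form_mono rare typ_N.
by lra.
Qed.

(** A unit of mass on popular vertices is charged [h * s] for the twins it misses; [h_k] keeps [h]
    close to 1. *)
Let h := (1 - 2 * d) * (1 - 2 * k%:R * tau).

Let d_small : 2 * d <= 16^-1.
Proof. by have := d_k; have := k_ge1; have := d_pos; nra. Qed.

Let ktau_small : 0 <= 2 * k%:R * tau <= 1.
Proof.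
apply/andP; split; first by rewrite !mulr_ge0 // ltW.
have := h_k; have : 0 <= k%:R * tau by rewrite mulr_ge0 // ltW.
by have := k_ge1; have := d_pos; nra.
Qed.

Let h_ge0 : 0 <= h.
Proof. by rewrite mulr_ge0 //; have := d_small; have /andP[] := ktau_small; lra. Qed.

Let hs_le : h * s <= lam.
Proof.
apply: le_trans card_twins_le; rewrite ler_wpM2r ?(ltW s_gt0) // /h mulrC.
by rewrite ler_wpM2r //; have := d_small; have := d_tau; lra.
Qed.

Lemma sum_miss_ge :
  (1 - 2 * k%:R * tau) * s * mu popular + tau * s * mu rare <=
  \sum_(w in T) (lam - me N w).
Proof.
rewrite -sum_miss (sum_setD _ popular_N); apply: lerD.
  rewrite /mu mulr_sumr; apply: ler_sum => y /popular_dg_T dy.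
  by rewrite mulrC ler_wpM2l // /miss; lra.
rewrite /mu mulr_sumr.
apply: le_trans (_ : \sum_(i in rare) x i * miss i <= _); last first.
  by apply: sum_subset (subsetDl _ _) _ => b _; rewrite mulr_ge0 ?miss_ge0 ?x_ge0.
apply: ler_sum => b /setDP[/setDP[bN b_unpop] bt]; rewrite mulrC ler_wpM2l //.
move: bt; rewrite inE b_unpop /= inE bN /= -ltNge => /ltW.
by [].
Qed.

(** For a twin, lam (1 - x w) is what it misses of N minus what it sees in W. The second part is
    paid back by the edge count of W: edges leaving [T] cancel, being counted twice there, and edges
    inside [T] leave only [d1 * s]. *)
Lemma far_cost_ge d1 : \sum_(w in T) dg T w <= d1 * s ->
  2 * (1 - 2 * d) * \sum_(w in T) (lam - me N w) - d1 * s <=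
  2 * \sum_(w in W) (1 - x w) * dg N w + \sum_(w in W) dg W w.
Proof.
move=> TT.
have d1_ge0 : 0 <= 1 - 2 * d by have := d_small; lra.
have cost1 : (1 - 2 * d) * \sum_(w in T) (lam * (1 - x w)) <=
    \sum_(w in W) (1 - x w) * dg N w.
  rewrite mulr_sumr; apply: le_trans (_ : \sum_(w in T) (1 - x w) * dg N w <= _).
    apply: ler_sum => w wT; rewrite mulrA mulrC ler_wpM2l ?subr_ge0 //.
    by apply: le_trans (me_le_dg x01 _ _); apply: T_me.
  by apply: sum_subset => // w _; apply: (far_cost_ge0 P).
have eqT : \sum_(w in T) (lam * (1 - x w)) =
    \sum_(w in T) (lam - me N w) - \sum_(w in T) me W w.
  rewrite -sumrB; apply: eq_bigr => w /(subsetP T_far)/(eig_W P).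
  by rewrite mulrBr mulr1 => ->; ring.
have leW : \sum_(w in T) me W w <= \sum_(w in T) dg T w + \sum_(w in T) dg (W :\: T) w.
  rewrite -big_split; apply: ler_sum => w _; apply: le_trans (me_le_dg x01 _ _) _.
  by rewrite /dg (sum_setD _ T_far).
have eqW : \sum_(w in W) dg W w = \sum_(w in T) dg T w +
    2 * \sum_(w in T) dg (W :\: T) w + \sum_(w in W :\: T) dg (W :\: T) w.
  have dgW D : \sum_(w in D) dg W w = \sum_(w in D) dg T w + \sum_(w in D) dg (W :\: T) w.
    by rewrite -big_split; apply: eq_bigr => w _; rewrite /dg (sum_setD _ T_far).
  by rewrite (sum_setD _ T_far) !dgW (sum_dg_sym R (W :\: T) T); ring.
have W0 : 0 <= \sum_(w in W :\: T) dg (W :\: T) w.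
  by apply: sumr_ge0 => w _; exact: dg_ge0.
have me0 : 0 <= \sum_(w in T) me W w by apply: sumr_ge0 => w _; exact: me_ge0.
have : (1 - 2 * d) * \sum_(w in T) me W w <= \sum_(w in T) me W w.
  by rewrite ler_piMl //; have := d_pos; lra.
by move: cost1 leW eqW TT; rewrite eqT mulrBr; lra.
Qed.

(** As [me N y <= lam], subtracting [h * s] from it loses at least the proportion h s / lam; then
    [sum_me_N] applies. *)
Lemma popular_gain :
  \sum_(y in popular) x y * me N y - h * s * mu popular <=
  (k%:R - 1) * lam - (k%:R - 1) * (h * s) + (M * (2 ^ M * k))%:R.
Proof.
set cst := (M * (2 ^ M * k))%:R.
have r_ge0 : 0 <= 1 - h * s / lam by rewrite subr_ge0 ler_pdivrMr // mul1r.
have r_le1 : 1 - h * s / lam <= 1.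
  rewrite gerBl; apply: divr_ge0 (ltW lam_gt0).
  exact: mulr_ge0 h_ge0 (ltW s_gt0).
apply: le_trans (_ : (1 - h * s / lam) * \sum_(y in popular) me N y <= _).
  rewrite /mu !mulr_sumr -sumrB; apply: ler_sum => y _.
  have -> : x y * me N y - h * s * x y = x y * (me N y - h * s) by ring.
  apply: le_trans (_ : x y * ((1 - h * s / lam) * me N y) <= _).
    rewrite ler_wpM2l // mulrBl mul1r lerD2l lerN2 mulrAC ler_pdivrMr //.
    by apply: ler_wpM2l (me_N_le P y); exact: mulr_ge0 h_ge0 (ltW s_gt0).
  by rewrite ler_piMl // mulr_ge0 ?me_ge0.
apply: le_trans (_ : (1 - h * s / lam) * ((k%:R - 1) * lam + cst) <= _).
  rewrite ler_wpM2l //; apply: le_trans (sum_me_N P k_ge3 wheel_free popular_N) _.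
  rewrite lerD2l ler_nat.
  by apply: leq_mul; rewrite ?leq_mul2r ?leq_pexp2l ?orbT // ltnW ?popular_few.
rewrite mulrDr; apply: lerD; last by rewrite ler_piMl // ler0n.
rewrite mulrBl mul1r; have -> : h * s / lam * ((k%:R - 1) * lam) = (k%:R - 1) * (h * s).
  by field; rewrite gt_eqF.
by [].
Qed.

(** The slack asks for 2(k-1) lam. The popular vertices, net of the twins they miss, supply
    2(k-1)(lam - h s), and the degrees on the two sides about (d1 + d2) s <= (2k-3) s. One unit of s
    is lacking, and half of it survives the error in [h]. *)
Lemma twins_not_many : False.
Proof.
have [d1 [d2 [/andP[d2_ge0 d2_le] d12 TT typ_sum]]] := degree_tradeoff.
have := far_cost_ge TT; have := slack_NN P slack; have := sum_NN_le P.
have := sum_N_split; have := popular_gain; have := sum_miss_ge.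
set NN := \sum_(v in N) \sum_(w in N) _; set NN' := \sum_(v in N) _.
set sY := \sum_(y in popular) _; set sZ := \sum_(z in rare) _.
set sT := \sum_(w in T) (lam - _); set S3 := \sum_(w in W) _ * _.
set S4 := \sum_(w in W) _.
move=> ge_T gainY splitN NN_le slk cost.
have sZ_le : sZ <= c * lam * mu rare.
  rewrite mulrC /sZ /mu mulr_suml; apply: ler_sum => z /setDP[/setDP[zN z_unpop] _].
  rewrite ler_wpM2l //; apply: ltW; move: z_unpop.
  by rewrite inE zN /= -ltNge.
have d1_ge0 : 0 <= 1 - 2 * d by have := d_small; lra.
(* Rare vertices do not earn their cost: they gain at most [c * lam] per unit of mass but miss more
   than [tau * s] twins, and s >= t0 lam. *)
have cost_Z : c * lam * mu rare <= (1 - 2 * d) * (tau * s * mu rare).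
  rewrite mulrA ler_wpM2r ?mu_ge0 //.
  have : tau * (t0 * lam) <= tau * s by rewrite ler_pM2l.
  have : 2 * c * lam <= tau * t0 * lam by rewrite ler_pM2r.
  have : 0 <= (1 - 2 * d - 2^-1) * (tau * s).
    by rewrite mulr_ge0 ?mulr_ge0 ?(ltW tau_pos) ?(ltW s_gt0) //; have := d_small; lra.
  by lra.
have cost_T : (1 - 2 * d) * ((1 - 2 * k%:R * tau) * s * mu popular + tau * s * mu rare) <=
    (1 - 2 * d) * sT by rewrite ler_wpM2l.
have main : 2 * (k%:R - 1) * (h * s) - d1 * s <= 2 * C + 2 * (M * (2 ^ M * k))%:R
    + d2 * (s + 2 * c * lam) + 4 * k%:R ^+ 2 * d * lam.
  have hE : h * s * mu popular = (1 - 2 * d) * ((1 - 2 * k%:R * tau) * s * mu popular).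
    by rewrite /h; ring.
  by move: gainY cost_T; rewrite hE mulrDr; move: slk cost; lra.
have k1 := k_ge1.
have h_big : (k%:R - 1) * (1 - h) <= 4^-1.
  have : 1 - h <= 2 * d + 2 * k%:R * tau.
    have /andP[kt _] := ktau_small.
    have : 0 <= 2 * d * (2 * k%:R * tau) by rewrite mulr_ge0 // mulr_ge0 // ltW.
    by rewrite /h; lra.
  move=> h1; have : (k%:R - 1) * (1 - h) <= (k%:R - 1) * (2 * d + 2 * k%:R * tau).
    by rewrite ler_wpM2l //; lra.
  have : 0 <= 2 * d + 2 * k%:R * tau by have /andP[] := ktau_small; have := d_pos; lra.
  by have := h_k; lra.
have s_half : 2^-1 * s <= (2 * (k%:R - 1) * h - d1 - d2) * s.
  by rewrite ler_pM2r //; lra.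
have d2c : d2 * (2 * c * lam) <= k%:R * (2 * c * lam).
  by rewrite ler_wpM2r // !mulr_ge0 // ltW.
have c1 : 16 * k%:R * c * lam <= t0 * lam by rewrite ler_pM2r.
have c2 : 32 * k%:R ^+ 2 * d * lam <= t0 * lam by rewrite ler_pM2r.
have t0_gt0 : 0 < t0.
  apply: lt_le_trans c_t0; rewrite mulr_gt0 // mulr_gt0 ?ltr0n //.
  by apply: leq_trans k_ge3.
have : 0 < t0 * lam by rewrite mulr_gt0.
have := s_large; have := C_lam; move: main s_half d2c c1 c2; lra.
Qed.

End Balanced.

(** * The core *)

Section Core.
Variables (R : realFieldType) (G : sgraph) (k : nat).
Variables (lam : R) (x : G -> R) (u : G).
Hypothesis P : perron_pair lam x u.
Hypothesis k_ge3 : (3 <= k)%N.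
Hypothesis wheel_free : subgraph_free (wheel (2 * k + 1)) G.
Variable C : R.
Hypothesis slack :
  \sum_v \sum_w @ind R G v w - 2 * C <= 2 * (lam ^+ 2 - (k%:R - 1) * lam).

Local Notation N := (nbr u).
Local Notation W := (far u).
Local Notation a := (@ind R G).
Local Notation dg := (@dg R G).
Local Notation me := (me x).
Local Notation mu := (mu x).
Let x01 := pp_x01 P.
Let x_ge0 := x_ge0 x01.
Let x_le1 := x_le1 x01.
Let lam_gt0 := pp_gt0 P.
Let k_ge3R : (3 : R) <= k%:R.
Proof. by rewrite ler_nat. Qed.

Variables (c eps : R) (M : nat) (D1 D2 D3 D4 : R).
Hypothesis c_pos : 0 < c.
Hypothesis eps_pos : 0 < eps.
Hypothesis eps_k : 12 * k%:R * eps <= 1.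
Hypothesis c_eps : c + 2 * eps <= 4^-1.
Hypothesis cM : 2 * k%:R <= c * M%:R.
Hypothesis M_lam : (M * (2 ^ M * k))%:R <= lam.
Hypothesis mu_W : mu W <= eps * lam.
Hypothesis D1_def : 2 * C + 2 * (M * (2 ^ M * k))%:R + M%:R ^+ 2 <= D1.
Hypothesis D1_ge1 : 1 <= D1.
Hypothesis D2_def : 5 * D1 + k%:R ^+ 2 <= D2.
Hypothesis D3_def : 2 + k%:R + 2 * D1 + D2 <= D3.
Hypothesis D4_def : 2 * D1 * D3 <= D4.
Hypothesis lam1 : 1 <= eps * lam.
Hypothesis lam2 : D1 <= eps * c * lam.
Hypothesis lam3 : 5 * D1 <= eps * lam.
Hypothesis lam4 : 4 * k%:R <= lam.
Hypothesis lam6 : 2 * (M * (2 ^ M * k))%:R <= lam.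
Hypothesis lam5 : 4 * (k%:R ^+ 2 * D4 + 3 * D1) < lam.

Let cst : R := (M * (2 ^ M * k))%:R.
Let lam_ge1 : 1 <= lam.
Proof. by have := lam4; have := k_ge3R; lra. Qed.
Let D4_ge0 : 0 <= D4.
Proof.
apply: le_trans D4_def; have := D3_def; have := D2_def; have := D1_ge1.
move=> h1 h2 h3; have := sqr_ge0 (k%:R : R); have := k_ge3R => h4 h5.
by rewrite mulr_ge0 //; lra.
Qed.

(* The clique K to be found is u |: Y. *)
Let Y := popular lam x u c.
Let Q := N :\: Y.
Let YN : Y \subset N := popular_N lam x u c.

Let cardY_lt : (#|Y| < M)%N.
Proof. exact: (popular_card P k_ge3 wheel_free c_pos cM M_lam). Qed.

(** With W light, an unpopular vertex of N has a small entry, so every edge inside [Q] contributes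
    at most -1/2 to the identity. *)
Lemma Q_small b : b \in Q -> x b <= 4^-1.
Proof.
move=> /setDP[bN]; rewrite inE bN /= -ltNge => b_unpop.
have := eig_N P bN; have := me_le_mu x01 W b => h1 h2.
rewrite -(ler_pM2l lam_gt0); apply: le_trans (_ : (c + 2 * eps) * lam <= _).
  by have := lam1; have := mu_W; lra.
by rewrite [lam * _]mulrC ler_pM2r.
Qed.

Lemma sum_NN_split (F : G -> G -> R) : (forall v w, F v w = F w v) ->
  \sum_(v in N) \sum_(w in N) a v w * F v w =
  \sum_(v in Y) \sum_(w in Y) a v w * F v w
  + 2 * \sum_(v in Y) \sum_(w in Q) a v w * F v w
  + \sum_(v in Q) \sum_(w in Q) a v w * F v w.
Proof.
move=> F_sym; have split (B : {set G}) :
    \sum_(v in B) \sum_(w in N) a v w * F v w =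
    \sum_(v in B) \sum_(w in Y) a v w * F v w + \sum_(v in B) \sum_(w in Q) a v w * F v w.
  by rewrite -big_split; apply: eq_bigr => v _; rewrite (sum_setD _ YN).
rewrite (sum_setD _ YN) !split [\sum_(v in Q) \sum_(w in Y) _]sum_ind_exchange -/Q.
under [X in _ + _ + (X + _)]eq_bigr => v _ do under eq_bigr => w _ do rewrite F_sym.
ring.
Qed.

Let S1 := \sum_(y in Y) (1 - x y) * dg N y.
Let S2 := \sum_(b in Q) dg Q b.
Let S3 := \sum_(w in W) (1 - x w) * dg N w.
Let S4 := \sum_(w in W) dg W w.

Let sum_QQ_le : \sum_(v in Q) \sum_(w in Q) a v w * (x v + x w - 1) <= - (2^-1 * S2).
Proof.
rewrite -mulrN mulrN /S2 mulr_sumr -sumrN; apply: ler_sum => v /Q_small xv.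
rewrite mulr_sumr -sumrN; apply: ler_sum => w /Q_small xw.
by rewrite mulrC -mulNr ler_wpM2r ?ind_ge0 //; lra.
Qed.

(** The rows of [Y] count twice and supply at most 2(k-1) lam + O(1) by [sum_me_N], which is what
    the slack demands. The other unbounded terms are all losses, so the four defects are bounded
    together. *)
Lemma slack_total : 2 * S1 + 2^-1 * S2 + 2 * S3 + S4 <= D1.
Proof.
have := slack_NN P slack; rewrite sum_NN_split => [|v w]; last by ring.
rewrite -/S3 -/S4 => slk.
have YN_sum : \sum_(v in Y) \sum_(w in N) a v w * (x v + x w - 1) =
    \sum_(y in Y) me N y - S1.
  rewrite -sumrB; apply: eq_bigr => y _; rewrite /me /dg mulr_sumr -sumrB.
  by apply: eq_bigr => w _; ring.
have YN_split : \sum_(v in Y) \sum_(w in N) a v w * (x v + x w - 1) =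
    \sum_(v in Y) \sum_(w in Y) a v w * (x v + x w - 1) +
    \sum_(v in Y) \sum_(w in Q) a v w * (x v + x w - 1).
  by rewrite -big_split; apply: eq_bigr => v _; rewrite (sum_setD _ YN).
have YY : - (\sum_(v in Y) \sum_(w in Y) a v w * (x v + x w - 1)) <= M%:R ^+ 2.
  rewrite -sumrN; apply: le_trans (_ : \sum_(v in Y) M%:R <= _).
    apply: ler_sum => v _; rewrite -sumrN; apply: le_trans (_ : \sum_(w in Y) (1 : R) <= _).
      apply: ler_sum => w _; have := x_ge0 v; have := x_ge0 w.
      by rewrite /ind; case: adj; rewrite ?mul1r ?mul0r; lra.
    by rewrite sum1_mu ler_nat ltnW.
  by rewrite sumr_const -(mulr_natr M%:R) expr2 ler_wpM2l // ler_nat ltnW.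
have := sum_me_N P k_ge3 wheel_free YN.
have : (#|Y| * (2 ^ #|Y| * k))%:R <= cst.
  by rewrite ler_nat; apply: leq_mul; rewrite ?leq_mul2r ?leq_pexp2l ?orbT // ltnW.
by have := sum_QQ_le; have := D1_def; rewrite -/cst; move: YN_sum YN_split YY slk; lra.
Qed.

Let S1_ge0 : 0 <= S1.
Proof. by apply: sumr_ge0 => y _; rewrite mulr_ge0 ?dg_ge0 ?subr_ge0. Qed.
Let S2_ge0 : 0 <= S2.
Proof. by apply: sumr_ge0 => y _; rewrite dg_ge0. Qed.
Let S3_ge0 : 0 <= S3.
Proof. by apply: sumr_ge0 => y _; rewrite mulr_ge0 ?dg_ge0 ?subr_ge0. Qed.
Let S4_ge0 : 0 <= S4.
Proof. by apply: sumr_ge0 => y _; rewrite dg_ge0. Qed.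

Let sum_term (A : {set G}) (F : G -> R) z : (forall v, 0 <= F v) -> z \in A ->
  F z <= \sum_(v in A) F v.
Proof. by move=> F0 zA; rewrite (bigD1 z) //= lerDl sumr_ge0. Qed.

Let S1_term y : y \in Y -> (1 - x y) * dg N y <= D1.
Proof.
move=> yY; apply: le_trans (_ : S1 <= _); last first.
  by have := slack_total; have := S1_ge0; have := S2_ge0; have := S3_ge0; have := S4_ge0; lra.
by apply: (sum_term (F := fun y => (1 - x y) * dg N y)) => // v; rewrite mulr_ge0 ?dg_ge0 ?subr_ge0.
Qed.

Let S3_term w : w \in W -> (1 - x w) * dg N w <= D1.
Proof.
move=> wW; apply: le_trans (_ : S3 <= _); last first.
  by have := slack_total; have := S1_ge0; have := S2_ge0; have := S3_ge0; have := S4_ge0; lra.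
by apply: (sum_term (F := fun y => (1 - x y) * dg N y)) => // v; rewrite mulr_ge0 ?dg_ge0 ?subr_ge0.
Qed.

Let S4_term w : w \in W -> dg W w <= D1.
Proof.
move=> wW; apply: le_trans (_ : S4 <= _); last first.
  by have := slack_total; have := S1_ge0; have := S2_ge0; have := S3_ge0; have := S4_ge0; lra.
by apply: (sum_term (F := dg W)) => // v; rewrite dg_ge0.
Qed.

Let S2_term b : b \in Q -> dg Q b <= 2 * D1.
Proof.
move=> bQ; apply: le_trans (_ : S2 <= _); last first.
  by have := slack_total; have := S1_ge0; have := S2_ge0; have := S3_ge0; have := S4_ge0; lra.
by apply: (sum_term (F := dg Q)) => // v; rewrite dg_ge0.
Qed.

Lemma Y_near1 y : y \in Y -> 1 - eps <= x y.
Proof.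
move=> yY; have := S1_term yY; have dy : c * lam <= dg N y.
  by apply: le_trans (me_le_dg x01 _ _); move: yY; rewrite inE => /andP[].
move=> h1; have : (1 - x y) * (c * lam) <= eps * (c * lam).
  apply: le_trans (_ : D1 <= _); last by have := lam2; lra.
  by apply: le_trans h1; rewrite ler_wpM2l // subr_ge0.
by rewrite ler_pM2r ?mulr_gt0 //; lra.
Qed.

Lemma Y_good y : y \in Y -> mu N - me N y <= 3 * eps * lam.
Proof.
move=> yY; have yN := subsetP YN _ yY; have := eig_N P yN.
have := me_le_mu x01 W y; have : (1 - eps) * lam <= x y * lam.
  by rewrite ler_wpM2r ?Y_near1 // ltW.
by rewrite (mu_N P); have := mu_W; have := lam1; lra.
Qed.

(** Each vertex of [Y] sees nearly [lam], so [k] of them would exceed the bound of [sum_me_N], while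
    fewer than k-1 could not supply the (k-1) lam - O(1) that the slack demands. *)
Lemma card_Y : #|Y| = k.-1.
Proof.
have le_sum := sum_me_N P k_ge3 wheel_free YN.
have le_cst : (#|Y| * (2 ^ #|Y| * k))%:R <= cst.
  by rewrite ler_nat; apply: leq_mul; rewrite ?leq_mul2r ?leq_pexp2l ?orbT // ltnW.
have D1_lam : 2 * D1 < lam.
  have : eps * lam <= lam * 12^-1.
    rewrite mulrC ler_wpM2l ?(ltW lam_gt0) //.
    have : 12 * 3 * eps <= 12 * k%:R * eps by rewrite ler_pM2r // ler_pM2l.
    by have := eps_k; have := eps_pos; lra.
  by have := lam3; have := D1_ge1; lra.
have cst_D1 : 2 * C + 2 * cst + M%:R ^+ 2 <= D1 by [].
have ge_sum : #|Y|%:R * ((1 - 3 * eps) * lam) <= \sum_(y in Y) me N y.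
  rewrite mulr_natl -sumr_const; apply: ler_sum => y /Y_good.
  by rewrite (mu_N P); lra.
have le_sum' : \sum_(y in Y) me N y <= #|Y|%:R * lam.
  by rewrite mulr_natl -sumr_const; apply: ler_sum => y _; apply: me_N_le P y.
have lower : (k%:R - 1) * lam - D1 <= \sum_(y in Y) me N y.
  have := slack_NN P slack; rewrite sum_NN_split => [|v w]; last by ring.
  rewrite -/S3 -/S4 => slk; have := sum_QQ_le.
  have YQ : \sum_(v in Y) \sum_(w in Q) a v w * (x v + x w - 1) <= \sum_(y in Y) me N y.
    apply: ler_sum => y _; apply: le_trans (_ : me Q y <= _).
      apply: ler_sum => w _; rewrite ler_wpM2l ?ind_ge0 //.
      by have := x_le1 y; lra.
    by apply: me_subset => //; apply: subsetDl.
  have YY : \sum_(v in Y) \sum_(w in Y) a v w * (x v + x w - 1) <= M%:R ^+ 2.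
    apply: le_trans (_ : \sum_(v in Y) M%:R <= _).
      apply: ler_sum => v _; apply: le_trans (_ : \sum_(w in Y) (1 : R) <= _).
        apply: ler_sum => w _; have := x_le1 v; have := x_le1 w.
        by rewrite /ind; case: adj; rewrite ?mul1r ?mul0r; lra.
      by rewrite sum1_mu ler_nat ltnW.
    by rewrite sumr_const -(mulr_natr M%:R) expr2 ler_wpM2l // ler_nat ltnW.
  have : 0 <= cst by exact: ler0n.
  by have := S2_ge0; have := S3_ge0; have := S4_ge0; have := D1_ge1; move: slk YQ YY cst_D1; lra.
apply/eqP; rewrite eqn_leq; apply/andP; split.
  rewrite leqNgt; apply/negP => kY.
  have {}kY : k%:R <= #|Y|%:R :> R.
    by rewrite ler_nat; move: kY k_ge3; clear; case: k.
  have e1 : 0 <= (1 - 3 * eps) * lam.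
    have : 12 * 3 * eps <= 12 * k%:R * eps by rewrite ler_pM2r // ler_pM2l.
    by move=> ?; rewrite mulr_ge0 ?(ltW lam_gt0) //; have := eps_k; lra.
  have : k%:R * ((1 - 3 * eps) * lam) <= #|Y|%:R * ((1 - 3 * eps) * lam).
    by rewrite ler_wpM2r.
  have : 12 * k%:R * eps * lam <= 1 * lam by rewrite ler_wpM2r // ltW.
  have := lam6; rewrite -/cst; have := lam_gt0; move: le_sum le_cst ge_sum; lra.
rewrite -ltnS -(ltr_nat R) -(ltr_pM2r lam_gt0) -[#|Y|.+1]addn1 natrD.
have -> : (k.-1)%:R = k%:R - 1 :> R by rewrite -subn1 natrB //; apply: leq_trans k_ge3.
by have := D1_ge1; move: lower le_sum' D1_lam; lra.
Qed.

Let km1 : (k.-1)%:R = k%:R - 1 :> R.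
Proof. by rewrite -subn1 natrB //; apply: leq_trans k_ge3. Qed.

(** The far vertices that could still act as twins of [u]; the aim is to show that there are
    none. *)
Let Tb := [set w in W | 2^-1 <= x w].
Let Ws := W :\: Tb.
Let TbW : Tb \subset W. Proof. by apply/subsetP => w; rewrite inE => /andP[]. Qed.

Lemma mu_Ws : lam * mu Ws <= 3 * D1.
Proof.
have WsW : Ws \subset W by exact: subsetDl.
have le1 : \sum_(w in Ws) dg N w <= 2 * S3.
  apply: le_trans (_ : \sum_(w in Ws) 2 * ((1 - x w) * dg N w) <= _).
    apply: ler_sum => w /setDP[wW]; rewrite inE wW /= -ltNge => xw.
    by rewrite mulrA ler_peMl ?dg_ge0 //; lra.
  rewrite -mulr_sumr ler_wpM2l //; apply: sum_subset => // w _.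
  exact: (far_cost_ge0 P).
have le2 : \sum_(w in Ws) dg W w <= S4.
  by apply: sum_subset => // w _; exact: dg_ge0.
have : lam * mu Ws <= \sum_(w in Ws) dg N w + \sum_(w in Ws) dg W w.
  rewrite mulr_sumr -big_split; apply: ler_sum => w /(subsetP WsW)/(eig_W P)->.
  by apply: lerD; apply: me_le_dg.
have := slack_total; have := S1_ge0; have := S2_ge0; have := S3_ge0; have := S4_ge0.
by have := D1_ge1; lra.
Qed.

Let mu_Ws1 : mu Ws <= 1.
Proof.
rewrite -(ler_pM2l lam_gt0) mulr1; apply: le_trans mu_Ws _.
have : 0 <= k%:R ^+ 2 * D4 by rewrite mulr_ge0 ?sqr_ge0.
by have := lam5; have := D1_ge1; lra.
Qed.

Let eps_lam : eps * lam <= lam * 36^-1.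
Proof.
rewrite mulrC ler_wpM2l ?(ltW lam_gt0) //.
have : 12 * 3 * eps <= 12 * k%:R * eps by rewrite ler_pM2r // ler_pM2l.
by have := eps_k; lra.
Qed.

Lemma Tb_dg w : w \in Tb -> lam <= 4 * me N w.
Proof.
rewrite inE => /andP[wW xw]; have := eig_W P wW.
have := me_le_dg x01 W w; have := S4_term wW.
have : lam * 2^-1 <= lam * x w by rewrite ler_pM2l.
by have := lam3; have := eps_lam; have := lam_gt0; have := D1_ge1; lra.
Qed.

Lemma Tb_near1 w : w \in Tb -> lam * (1 - x w) <= 4 * D1.
Proof.
move=> wT; have := S3_term (subsetP TbW _ wT); have := Tb_dg wT.
have := me_le_dg x01 N w; have := x_le1 w => h1 h2 h3.
have : (1 - x w) * lam <= (1 - x w) * (4 * dg N w) by rewrite ler_wpM2l ?subr_ge0 //; lra.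
by move=> h4 h5; rewrite mulrC; lra.
Qed.

Lemma Tb_good w : w \in Tb -> mu N - me N w <= 3 * eps * lam.
Proof.
move=> wT; have wW := subsetP TbW _ wT; have := eig_W P wW.
have := me_le_dg x01 W w; have := S4_term wW; have := Tb_near1 wT.
by rewrite (mu_N P); have := lam3; have := D1_ge1; lra.
Qed.

(** The neighbours of [y] in [u |: (Y :|: Tb)] see nearly all of N, as [y] does, so [k] of them
    would make [y] the hub of a wheel; [u] is one of them. *)
Lemma good_degree y : y \in Y ->
  (#|Y :&: nbr y| + #|Tb :&: nbr y| < k.-1)%N.
Proof.
move=> yY; pose A := u |: (Y :|: Tb).
have good z : z \in A -> mu N - me N z <= 3 * eps * lam.
  rewrite !in_setU in_set1 => /orP[/eqP->|/orP[/Y_good|/Tb_good] //].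
  by rewrite (me_N_u P) (mu_N P) subrr !mulr_ge0 ?(ltW eps_pos) ?(ltW lam_gt0).
have uy : adj y u by have := subsetP YN _ yY; rewrite inE adj_sym.
have A_deg : (#|A :&: nbr y| < k)%N.
  rewrite ltnNge; apply/negP => k_le; case: wheel_free.
  apply: (@wheel_of_mass R G k x y N (A :&: nbr y) (3 * eps * lam) (3 * eps * lam)) => //.
  - exact: subsetIr.
  - exact: Y_good.
  - by move=> z /setIP[/good].
  - rewrite (mu_N P); have : 12 * k%:R * eps * lam <= 1 * lam by rewrite ler_wpM2r // ltW.
    by have := lam4; have := eps_lam; have := lam_gt0; lra.
have YT : Y :&: nbr y :&: (Tb :&: nbr y) = set0.
  apply/setP => z; rewrite !in_setI in_set0; apply/negP.
  move=> /andP[/andP[/(subsetP YN) zN _] /andP[/(subsetP TbW) + _]].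
  by move: zN; rewrite !inE => ->; rewrite andbF.
have AE : A :&: nbr y = u |: ((Y :&: nbr y) :|: (Tb :&: nbr y)).
  apply/setP => z; rewrite !in_setI !in_setU !in_setI in_set1 [z \in nbr y]inE.
  by case: eqP => [->|_] /=; [rewrite uy | rewrite -andb_orl].
have unotin : u \notin (Y :&: nbr y) :|: (Tb :&: nbr y).
  rewrite in_setU !in_setI negb_or !negb_and; apply/andP; split; apply/orP; left.
    by apply/negP => /(subsetP YN); rewrite inE adj_irrefl.
  by apply/negP => /(subsetP TbW); rewrite inE eqxx.
move: A_deg; rewrite AE cardsU1 unotin cardsU YT cards0 subn0.
by move: k_ge3; clear; lia.
Qed.

Let dg_cards y : y \in Y -> dg Y y + dg Tb y <= k%:R - 2.
Proof.
move=> /good_degree; rewrite !dg_card -natrD.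
have -> : k%:R - 2 = (k.-2)%:R :> R by rewrite -subn2 natrB //; apply: leq_trans k_ge3.
by rewrite ler_nat; move: k_ge3; clear; lia.
Qed.

Let mu_N_split : mu Y + mu Q = lam.
Proof. by rewrite -(mu_N P) /mu (sum_setD _ YN). Qed.

Let me_N_split v : me N v = me Y v + me Q v.
Proof. by rewrite /me (sum_setD _ YN). Qed.

Let me_W_split v : me W v = me Tb v + me Ws v.
Proof. by rewrite /me (sum_setD _ TbW). Qed.

(** A vertex of [Tb] with no neighbour in [Y] or W misses mass at least 1, which costs at least 1/4;
    [good_degree] and [S4] bound the exceptional adjacencies. *)
Lemma card_Tb : #|Tb|%:R <= D2.
Proof.
have muY : 1 <= mu Y.
  have : (k%:R - 1) * (1 - eps) <= mu Y.
    rewrite -km1 -card_Y mulr_natl -sumr_const; apply: ler_sum => y; exact: Y_near1.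
  have : 2 * (1 - eps) <= (k%:R - 1) * (1 - eps).
    by rewrite ler_wpM2r //; have := k_ge3R; have := c_eps; have := c_pos; lra.
  by have := c_eps; have := c_pos; lra.
have term w : w \in Tb -> 1 - dg Y w - dg W w <= 4 * ((1 - x w) * dg N w).
  move=> wT; have wW := subsetP TbW _ wT; have := eig_W P wW.
  have := me_le_dg x01 W w; have := me_le_dg x01 Y w; have := me_le_mu x01 Q w.
  have := Tb_dg wT; have := me_le_dg x01 N w => h1 h2 h3 h4 h5 h6.
  have : (1 - x w) * lam <= (1 - x w) * (4 * dg N w) by rewrite ler_wpM2l ?subr_ge0 //; lra.
  by move: h6; rewrite me_N_split; have := mu_N_split; lra.
have sum_T : \sum_(w in Tb) (1 - dg Y w - dg W w) <= 4 * S3.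
  apply: le_trans (ler_sum _ term) _; rewrite -mulr_sumr ler_wpM2l //.
  by apply: sum_subset => // w _; exact: (far_cost_ge0 P).
have sumW : \sum_(w in Tb) dg W w <= S4 by apply: sum_subset => // w _; exact: dg_ge0.
have sumY : \sum_(w in Tb) dg Y w <= k%:R ^+ 2.
  rewrite sum_dg_sym; apply: le_trans (_ : \sum_(y in Y) k%:R <= _).
    apply: ler_sum => y /dg_cards; have := dg_ge0 R Y y; lra.
  rewrite sumr_const card_Y -(mulr_natr k%:R) expr2 ler_wpM2l // ler_nat.
  exact: leq_pred.
move: sum_T; rewrite !sumrB sumr_const.
have := slack_total; have := S1_ge0; have := S2_ge0; have := S3_ge0; have := S4_ge0.
by have := D2_def; have := D1_ge1; lra.
Qed.

Lemma Q_tiny b : b \in Q -> lam * x b <= D3.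
Proof.
move=> bQ; have bN := subsetP (subsetDl N Y) _ bQ; have := eig_N P bN.
rewrite me_N_split me_W_split.
have := le_trans (me_le_dg x01 Y b) (dg_le_card R Y b); rewrite card_Y km1.
have := le_trans (me_le_dg x01 Q b) (S2_term bQ).
have := le_trans (le_trans (me_le_dg x01 Tb b) (dg_le_card R Tb b)) card_Tb.
have := le_trans (me_le_mu x01 Ws b) mu_Ws1.
by have := D3_def; lra.
Qed.

Let D3_gt0 : 0 < D3.
Proof.
have := D3_def; have := D2_def; have := D1_ge1; have := sqr_ge0 (k%:R : R).
by have := k_ge3R; lra.
Qed.

(** Since entries in [Q] are O(1 / lam), seeing mass of order [lam] takes order lam^2 neighbours.
    The bounded costs then improve the bounds on 1 - x to O(1 / lam^2). *)
Let good_dg z : mu N - me N z <= 3 * eps * lam -> lam ^+ 2 <= 2 * D3 * dg N z.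
Proof.
move=> z_good; have muY : mu Y <= k%:R - 1 by rewrite -km1 -card_Y mu_le_card.
have meY := le_trans (me_le_mu x01 Y z) muY.
have Q_dg : lam * me Q z <= D3 * dg Q z.
  rewrite /me /dg !mulr_sumr; apply: ler_sum => b bQ.
  by rewrite mulrCA [D3 * _]mulrC ler_wpM2l ?ind_ge0 ?Q_tiny.
have Q_half : lam <= 2 * me Q z.
  move: z_good; rewrite (mu_N P) me_N_split; have := eps_lam; have := lam4.
  by have := meY; have := lam_gt0; lra.
have : dg Q z <= dg N z by apply/dg_subset/subsetDl.
move=> dQN; have : D3 * dg Q z <= D3 * dg N z by rewrite ler_pM2l.
have : lam * lam <= lam * (2 * me Q z) by rewrite ler_pM2l.
by rewrite expr2; move: Q_dg; lra.
Qed.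

Lemma Y_very_near1 y : y \in Y -> lam ^+ 2 * (1 - x y) <= D4.
Proof.
move=> yY; apply: le_trans D4_def; rewrite mulrC.
apply: le_trans (_ : (1 - x y) * (2 * D3 * dg N y) <= _).
  by rewrite ler_wpM2l ?subr_ge0 ?good_dg ?Y_good.
have := S1_term yY => h; have : D3 * ((1 - x y) * dg N y) <= D3 * D1 by rewrite ler_pM2l.
by lra.
Qed.

Lemma Tb_very_near1 w : w \in Tb -> lam ^+ 2 * (1 - x w) <= D4.
Proof.
move=> wT; apply: le_trans D4_def; rewrite mulrC.
apply: le_trans (_ : (1 - x w) * (2 * D3 * dg N w) <= _).
  by rewrite ler_wpM2l ?subr_ge0 ?good_dg ?Tb_good.
have := S3_term (subsetP TbW _ wT) => h.
have : D3 * ((1 - x w) * dg N w) <= D3 * D1 by rewrite ler_pM2l.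
by lra.
Qed.

Hypothesis C_sharp : 2 * C <= k%:R * (k%:R - 1) + 2^-1 * k%:R.

Let muY_ge : 0 <= lam * (k%:R - 1 - mu Y) <= (k%:R - 1) * D4.
Proof.
have -> : k%:R - 1 - mu Y = \sum_(y in Y) (1 - x y) by rewrite sumrB sum1_mu card_Y km1.
have s0 : 0 <= \sum_(y in Y) (1 - x y) by apply: sumr_ge0 => y _; rewrite subr_ge0.
rewrite mulr_ge0 ?(ltW lam_gt0) //=.
apply: le_trans (_ : lam ^+ 2 * \sum_(y in Y) (1 - x y) <= _).
  by rewrite ler_wpM2r // expr2 ler_peMl // ltW.
rewrite mulr_sumr -km1 -card_Y mulr_natl -sumr_const; apply: ler_sum => y.
exact: Y_very_near1.
Qed.

Let very_near1_lam z : lam ^+ 2 * (1 - x z) <= D4 -> lam * (1 - x z) <= D4.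
Proof.
apply: le_trans; rewrite ler_wpM2r ?subr_ge0 // expr2 ler_peMl //.
exact: ltW.
Qed.

Let k2D4 : 9 * D4 <= k%:R ^+ 2 * D4 /\ k%:R * D4 <= k%:R ^+ 2 * D4.
Proof.
have k3 := k_ge3R; have h : 0 <= (k%:R - 3) * (k%:R : R) by rewrite mulr_ge0 //; lra.
by split; rewrite ler_wpM2r // expr2; lra.
Qed.

(** lam (1 - x w) is at least about k-1 minus the degree of [w] into [Y] and [Tb], yet it is O(1 /
    lam); being an integer, that degree reaches k-1. *)
Lemma Tb_degree w : w \in Tb -> (k.-1 <= #|Y :&: nbr w| + #|Tb :&: nbr w|)%N.
Proof.
move=> wT; have wW := subsetP TbW _ wT; have := eig_W P wW.
rewrite me_N_split me_W_split => eig.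
have mY := me_le_dg x01 Y w; have mT := me_le_dg x01 Tb w.
have mQ := me_le_mu x01 Q w; have mWs := me_le_mu x01 Ws w.
have near := Tb_very_near1 wT.
have h1 : lam * (mu Y - dg Y w - dg Tb w - mu Ws) <= D4.
  apply: le_trans near; rewrite expr2 -mulrA ler_pM2l //.
  by move: eig; have := mu_N_split; lra.
rewrite -ltnS -(ltr_nat R) -[(_ + _).+1]addn1 !natrD km1 -!dg_card.
rewrite -(ltr_pM2l lam_gt0); have [_ kD] := k2D4.
have /andP[m0 m1] := muY_ge.
by have := mu_Ws; have := lam5; have := D1_ge1; have := D4_ge0; lra.
Qed.

Let sumYY := \sum_(y in Y) dg Y y.

(** Compared with [slack_total], edges inside [Y] enter through their actual number and the [Y]-[Q]
    terms are at most k-1 per unit of mass, which keeps the constant terms sharp. *)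
Lemma slack_sharp : S4 + 2 * (k%:R - 1) * mu Y <= 2 * C + sumYY.
Proof.
have := slack_NN P slack; rewrite sum_NN_split => [|v w]; last by ring.
rewrite -/S3 -/S4 => slk; have := sum_QQ_le.
have YQ : \sum_(v in Y) \sum_(w in Q) a v w * (x v + x w - 1) <= (k%:R - 1) * mu Q.
  rewrite -km1 -card_Y mulr_natl -sumr_const.
  apply: ler_sum => y _; apply: le_trans (_ : me Q y <= _); last exact: me_le_mu.
  apply: ler_sum => w _; rewrite ler_wpM2l ?ind_ge0 //.
  by have := x_le1 y; lra.
have YY : \sum_(v in Y) \sum_(w in Y) a v w * (x v + x w - 1) <= sumYY.
  apply: ler_sum => v _; apply: ler_sum => w _.
  by rewrite ler_piMr ?ind_ge0 //; have := x_le1 v; have := x_le1 w; lra.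
move: YQ; have -> : mu Q = lam - mu Y by rewrite -mu_N_split; ring.
by have := S2_ge0; have := S3_ge0; lra.
Qed.

(** If [Tb] is nonempty, its degrees into [Y] and [Tb] total at least k-1. Those into [Y] are at
    most (k-1)(k-2) - [sumYY] by [good_degree], those into [Tb] at most [S4], and [slack_sharp]
    bounds S4 - sumYY. Together k-1 < (k+1)/2, false for k >= 3; at k = 3 the strictness of [m2]
    decides. *)
Lemma Tb_empty : Tb = set0.
Proof.
apply/eqP; rewrite -cards_eq0 -leqn0 leqNgt; apply/negP => T_gt0.
have deg : k%:R - 1 <= \sum_(w in Tb) (dg Y w + dg Tb w).
  apply: le_trans (_ : \sum_(w in Tb) (k%:R - 1) <= _).
    rewrite sumr_const -(mulr_natr (k%:R - 1)) ler_peMr ?ler1n //.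
    by have := k_ge3R; lra.
  by apply: ler_sum => w /Tb_degree; rewrite !dg_card -natrD -km1 ler_nat.
have TT : \sum_(w in Tb) dg Tb w <= S4.
  apply: le_trans (_ : \sum_(w in Tb) dg W w <= _).
    by apply: ler_sum => w _; exact: dg_subset.
  by apply: sum_subset => // w _; exact: dg_ge0.
have YT : \sum_(w in Tb) dg Y w <= (k%:R - 1) * (k%:R - 2) - sumYY.
  rewrite sum_dg_sym lerBrDr -big_split /= -km1 -card_Y mulr_natl -sumr_const.
  by apply: ler_sum => y /dg_cards; lra.
move: deg; rewrite big_split /=; have := slack_sharp.
have /andP[m0 m1] := muY_ge.
have m2 : 2 * (k%:R - 1) * (k%:R - 1 - mu Y) < 2^-1.
  rewrite -(ltr_pM2l lam_gt0).
  have : 2 * (k%:R - 1) * (lam * (k%:R - 1 - mu Y)) <= 2 * (k%:R - 1) * ((k%:R - 1) * D4).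
    by rewrite ler_wpM2l //; have := k_ge3R; lra.
  have : 2 * (k%:R - 1) * ((k%:R - 1) * D4) <= 2 * (k%:R ^+ 2 * D4).
    have : (k%:R - 1) * (k%:R - 1) <= k%:R ^+ 2 :> R by rewrite expr2; have := k_ge3R; lra.
    by move/(ler_wpM2r D4_ge0); lra.
  by have := lam5; have := D1_ge1; lra.
by have := C_sharp; have := k_ge3R; lra.
Qed.

Let Ws_W : Ws = W.
Proof. by rewrite /Ws Tb_empty setD0. Qed.

(** The eigenvalue equation expresses lam (1 - x y) by the mass that [y] misses in N, and
    [Y_very_near1] allows one more factor [lam]. The [- 1] is the weight of [u], which offsets that
    [y] misses itself. *)
Lemma Y_balance y : y \in Y ->
  lam * (mu Y - me Y y - 1) + lam * (mu Q - me Q y) <= D4 + 3 * D1.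
Proof.
move=> yY; have := eig_N P (subsetP YN _ yY); rewrite me_N_split => eig.
have := Y_very_near1 yY; have := mu_Ws; rewrite Ws_W => muW.
have := me_le_mu x01 W y => mW.
rewrite expr2 -mulrA => near.
have : lam * me W y <= lam * mu W by rewrite ler_pM2l.
have : lam * (lam * (1 - x y)) = lam * (mu Y + mu Q - (1 + (me Y y + me Q y) + me W y)).
  by rewrite mulrBr mulr1 eig mu_N_split.
by move: near muW; lra.
Qed.

Let miss_sum v (A : {set G}) : mu A - me A v = \sum_(w in A) (1 - a v w) * x w.
Proof. by rewrite /mu /me -sumrB; apply: eq_bigr => w _; ring. Qed.

Let miss_term_ge0 v w : 0 <= (1 - a v w) * x w.
Proof. by rewrite mulr_ge0 // subr_ge0 ind_le1. Qed.

(** A missed vertex of [Y] besides [y] would raise the missed mass from about 1 to about 2, an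
    excess of order [lam] in [Y_balance]. *)
Lemma Y_clique : {in Y &, forall y z, y != z -> adj y z}.
Proof.
move=> y z yY zY yz; apply/negPn/negP => nadj.
have ge2 : x y + x z <= mu Y - me Y y.
  rewrite miss_sum (bigD1 y) //= (bigD1 z) /=; last by rewrite zY eq_sym.
  rewrite ind_irrefl (ind_nadj R nadj) !subr0 !mul1r lerD2l lerDl.
  by apply: sumr_ge0 => w _; exact: miss_term_ge0.
have Q0 : 0 <= lam * (mu Q - me Q y).
  by rewrite mulr_ge0 ?(ltW lam_gt0) // subr_ge0 me_le_mu.
have := Y_balance yY; have := very_near1_lam (Y_very_near1 yY).
have := very_near1_lam (Y_very_near1 zY).
have : lam * (x y + x z) <= lam * (mu Y - me Y y) by rewrite ler_pM2l.
have [D _] := k2D4; have := lam5; have := D1_ge1; have := D4_ge0.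
by move: Q0; lra.
Qed.

(** Every vertex of [Q] is adjacent to [u], so lam x b >= 1, and each one missed by [y] costs at
    least 1 in [Y_balance]. *)
Lemma Q_miss y : y \in Y -> \sum_(b in Q) (1 - a y b) <= 2 * D4 + 3 * D1.
Proof.
move=> yY.
have ge1 : x y <= mu Y - me Y y.
  rewrite miss_sum (bigD1 y) //= ind_irrefl subr0 mul1r lerDl.
  by apply: sumr_ge0 => w _; exact: miss_term_ge0.
have : lam * x y <= lam * (mu Y - me Y y) by rewrite ler_pM2l.
have := Y_balance yY; have := very_near1_lam (Y_very_near1 yY).
suff : \sum_(b in Q) (1 - a y b) <= lam * (mu Q - me Q y) by lra.
rewrite miss_sum mulr_sumr; apply: ler_sum => b /setDP[bN _].
rewrite mulrCA ler_peMr ?subr_ge0 ?ind_le1 // (eig_N P bN).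
by rewrite -addrA lerDl addr_ge0 // me_ge0.
Qed.

Let K := u |: Y.

Let sum_W_dg_N : \sum_(w in W) dg N w <= D1.
Proof.
apply: le_trans (_ : \sum_(w in W) 2 * ((1 - x w) * dg N w) <= _).
  apply: ler_sum => w wW.
  have : w \notin Tb by rewrite Tb_empty in_set0.
  rewrite inE wW /= -ltNge => xw.
  by rewrite mulrA ler_peMl ?dg_ge0 //; lra.
rewrite -mulr_sumr -/S3.
by have := slack_total; have := S1_ge0; have := S2_ge0; have := S4_ge0; lra.
Qed.

Lemma setC_K : ~: K = Q :|: W.
Proof.
apply/setP => b; rewrite in_setC in_setU1 in_setU in_setD negb_or.
have := subsetP YN b; rewrite [b \in N]inE [b \in W]inE; case: (b =P u) => [->|_] /=.
  by rewrite adj_irrefl andbF.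
by case: (b \in Y) => /= [->|_] //; case: adj.
Qed.

Let QW : [disjoint Q & W].
Proof.
rewrite -setI_eq0; apply/eqP/setP => b; rewrite in_setI in_setD !inE.
by case: adj; rewrite ?andbF.
Qed.

Lemma core_structure (D6 D7 : R) : D3 <= D6 -> 3 * D1 <= D6 ->
  k%:R * (2 * D4 + 3 * D1) + D1 <= D7 ->
  exists K : {set G}, [/\ #|K| = k, {in K &, forall y z, y != z -> adj y z},
    {in K, forall z, lam ^+ 2 * (1 - x z) <= D4},
    {in ~: K, forall b, lam * x b <= D6} &
    \sum_(b in ~: K) dg (~: K) b <= 5 * D1 /\
    #|[set b in ~: K | (0 < #|K :&: nbr b| < k)%N]|%:R <= D7].
Proof.
move=> D6a D6b D7_def; exists K; rewrite setC_K; split.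
- rewrite cardsU1 card_Y; have -> : u \notin Y.
    by apply/negP => /(subsetP YN); rewrite inE adj_irrefl.
  by move: k_ge3; clear; case: k.
- move=> y z; rewrite !in_setU1 => /orP[/eqP->|yY] /orP[/eqP->|zY] //.
  + by rewrite eqxx.
  + by move: (subsetP YN _ zY); rewrite inE.
  + by move: (subsetP YN _ yY); rewrite inE adj_sym.
  + exact: Y_clique.
- move=> z; rewrite in_setU1 => /orP[/eqP->|/Y_very_near1 //].
  by rewrite (pp_xu P) subrr mulr0.
- move=> b; rewrite in_setU => /orP[/Q_tiny|bW]; first by move/le_trans; apply.
  apply: le_trans D6b; apply: le_trans mu_Ws; rewrite ler_pM2l // Ws_W.
  by apply: (sum_term (F := x)).
split.
  have split A : \sum_(b in A) dg (Q :|: W) b = \sum_(b in A) dg Q b + \sum_(b in A) dg W b.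
    by rewrite -big_split; apply: eq_bigr => b _; rewrite /dg sum_setU.
  rewrite sum_setU // !split (sum_dg_sym R Q W) -/S2 -/S4.
  have : \sum_(w in W) dg Q w <= \sum_(w in W) dg N w.
    by apply: ler_sum => w _; apply/dg_subset/subsetDl.
  have := sum_W_dg_N.
  by have := slack_total; have := S1_ge0; have := S3_ge0; have := S2_ge0; have := S4_ge0; lra.
apply: le_trans D7_def; rewrite -sum1_mu.
apply: le_trans (_ : \sum_(b in Q :|: W) (if (0 < #|K :&: nbr b| < k)%N then 1 else 0) <= _).
  by rewrite -big_mkcondr /= le_eqVlt; apply/orP; left; apply/eqP/eq_bigl => b; rewrite inE.
(* A partial vertex of W has a neighbour in N, and there are at most [D1] edges between W and N. *)
rewrite sum_setU //; apply: lerD; last first.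
  apply: le_trans sum_W_dg_N; apply: ler_sum => w; rewrite inE => /andP[wu uw].
  case: ifP => [/andP[K_gt0 _]|_]; last exact: dg_ge0.
  rewrite dg_card ler1n; apply: leq_trans K_gt0 _; apply: subset_leq_card.
  apply/subsetP => z /setIP[]; rewrite in_setU1 => /orP[/eqP->|/(subsetP YN) zN].
    by rewrite inE adj_sym (negbTE uw).
  by move=> zw; apply/setIP.
(* A partial vertex of [Q] is adjacent to [u], so it misses some vertex of [Y] and is counted by
   [Q_miss]. *)
apply: le_trans (_ : \sum_(b in Q) \sum_(y in Y) (1 - a y b) <= _); last first.
  rewrite exchange_big; apply: le_trans (_ : \sum_(y in Y) (2 * D4 + 3 * D1) <= _).
    by apply: ler_sum => y; exact: Q_miss.
  rewrite sumr_const -(mulr_natl (2 * D4 + 3 * D1)) card_Y ler_wpM2r ?ler_nat ?leq_pred //.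
  by have := D4_ge0; have := D1_ge1; lra.
apply: ler_sum => b bQ; case: ifP => [/andP[_ K_lt]|_]; last first.
  by apply: sumr_ge0 => y _; rewrite subr_ge0 ind_le1.
have [y yY nadj] : exists2 y, y \in Y & ~~ adj y b.
  apply/exists_inP; rewrite -[[exists _ in _, _]]negbK negb_exists_in.
  apply/negP => /forall_inP all_adj; move: K_lt; rewrite ltnNge.
  have -> : K :&: nbr b = K.
    apply/setIidPl/subsetP => z; rewrite in_setU1 => /orP[/eqP->|zY].
      by move: bQ => /setDP[]; rewrite !inE adj_sym.
    by rewrite inE adj_sym; apply/negPn; apply: all_adj.
  rewrite cardsU1 card_Y; have -> : u \notin Y.
    by apply/negP => /(subsetP YN); rewrite inE adj_irrefl.
  by move: k_ge3; clear; case: k => // n; rewrite add1n leqnn.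
rewrite (bigD1 y) //= (ind_nadj R nadj) subr0 lerDl.
by apply: sumr_ge0 => z _; rewrite subr_ge0 ind_le1.
Qed.

End Core.

(** * From the clique core to a sum of squares *)

Section Squares.
Variables (R : realFieldType) (G : sgraph) (k q r : nat).
Variables (lam : R) (x : G -> R) (u : G).
Hypothesis P : perron_pair lam x u.
Hypothesis k_ge3 : (3 <= k)%N.
Variables (K : {set G}) (D1 D4 D6 D7 : R).
Local Notation B := (~: K).
Local Notation dg := (@dg R G).
Local Notation me := (me x).
Local Notation mu := (mu x).
Let x01 := pp_x01 P.
Let x_ge0 := x_ge0 x01.
Let x_le1 := x_le1 x01.
Let lam_gt0 := pp_gt0 P.
Hypothesis cardK : #|K| = k.
Hypothesis K_clique : {in K &, forall y z, y != z -> adj y z}.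
Hypothesis K_near1 : {in K, forall z, lam ^+ 2 * (1 - x z) <= D4}.
Hypothesis B_small : {in B, forall b, lam * x b <= D6}.
Hypothesis B_edges : \sum_(b in B) dg B b <= D1.
Hypothesis B_partial : #|[set b in B | (0 < #|K :&: nbr b| < k)%N]|%:R <= D7.
Hypothesis lam_sharp : k%:R * q%:R + r%:R ^+ 2 / k%:R <= lam ^+ 2 - (k%:R - 1) * lam.
Hypothesis lam_ge1 : 1 <= lam.
Hypothesis D_ge0 : [/\ 0 <= D1, 0 <= D4, 0 <= D6 & 0 <= D7].
Hypothesis lam_large1 : 2 * (k%:R * D6 * D1) < lam.
Hypothesis lam_large2 : 2 * (k%:R * D4 * (k%:R ^+ 2 * D7 + 1)) < lam.

Let k_gt0 : (0 : R) < k%:R.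
Proof. by rewrite ltr0n; apply: leq_trans k_ge3. Qed.

Let X := mu K.

Lemma sum_K_eig : (lam ^+ 2 - (k%:R - 1) * lam) * X =
  \sum_(b in B) dg K b * me K b + \sum_(b in B) dg K b * me B b.
Proof.
have split v : lam * x v = me K v + me B v.
  by rewrite (pp_eig P) (bigID (mem K)) /=; congr (_ + _); apply: eq_bigl => w; rewrite ?inE.
have meK v : v \in K -> me K v = X - x v.
  move=> vK; rewrite /me /X /mu (bigD1 v) //= ind_irrefl mul0r add0r.
  rewrite [in RHS](bigD1 v) //= addrAC subrr add0r; apply: eq_bigr => w /andP[wK wv].
  by rewrite ind_adj ?mul1r // K_clique // eq_sym.
have lamX : lam * X = (k%:R - 1) * X + \sum_(b in B) dg K b * x b.
  rewrite -sum_me_dg {1}/X /mu mulr_sumr.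
  under eq_bigr => v vK do rewrite split meK //.
  by rewrite big_split sumrB /= sumr_const cardK -mulr_natl -/(mu K) -/X; ring.
have -> : (lam ^+ 2 - (k%:R - 1) * lam) * X = lam * \sum_(b in B) dg K b * x b.
  have -> : \sum_(b in B) dg K b * x b = lam * X - (k%:R - 1) * X by rewrite lamX; ring.
  by ring.
rewrite mulr_sumr -big_split.
by apply: eq_bigr => b _; rewrite /= mulrCA split mulrDr.
Qed.

Let dK b := #|K :&: nbr b|.
Let full := [set b in B | dK b == k].
Let part := [set b in B | (0 < dK b < k)%N].

Let dK_le b : (dK b <= k)%N.
Proof. by rewrite -cardK subset_leq_card ?subsetIl. Qed.

Let sum_B_split (F : G -> R) : (forall b, dK b = 0%N -> F b = 0) ->
  \sum_(b in B) F b = \sum_(b in full) F b + \sum_(b in part) F b.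
Proof.
move=> F0; rewrite (bigID (mem full)) (bigID (mem part) (fun b => (b \in B) && ~~ _)) /=.
rewrite [X in _ + (_ + X)]big1 ?addr0 => [|b]; last first.
  move=> /andP[/andP[bB nf] np]; apply: F0; apply/eqP; move: nf np.
  rewrite !(inE, in_setC) in bB *; rewrite bB /= lt0n negb_and negbK -leqNgt.
  move=> nf /orP[//|k_le]; case/negP: nf; rewrite eqn_leq k_le andbT.
  exact: dK_le.
congr (_ + _); apply: eq_bigl => b; rewrite !inE; first by case: (b \in K).
case: (b \in K) => //=; case: (dK b =P k) => [->|_] /=; last by [].
by rewrite ltnn andbF.
Qed.

Let part_le (F : G -> R) c : (forall b, b \in part -> F b <= c) -> 0 <= c ->
  \sum_(b in part) F b <= c * D7.
Proof.
move=> Fc c_ge0; apply: le_trans (_ : c * #|part|%:R <= _); last by rewrite ler_wpM2l.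
by rewrite mulr_natr -sumr_const; apply: ler_sum.
Qed.

Let F := #|full|.
Let Pp : R := \sum_(b in part) (dK b)%:R ^+ 2.

Let X_le : X <= k%:R.
Proof. by rewrite -cardK; apply: mu_le_card. Qed.

Let X_ge : lam ^+ 2 * (k%:R - X) <= k%:R * D4.
Proof.
rewrite -cardK -sum1_mu /X /mu -sumrB mulr_sumr mulr_suml.
by apply: ler_sum => z /K_near1; rewrite mul1r.
Qed.

(** In [sum_K_eig] a vertex joined to all of [K] contributes k X, a partial one at most the square
    of its degree, and the edges inside B only O(1 / lam), since entries there are O(1 / lam). *)
Let main_le : lam * ((k%:R * q%:R + r%:R ^+ 2 / k%:R - k%:R * F%:R) * X) <=
  lam * Pp + k%:R * D6 * D1.
Proof.
have [D1_ge0 D4_ge0 D6_ge0 D7_ge0] := D_ge0.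
have X_ge0 : 0 <= X by exact: mu_ge0.
have le1 : \sum_(b in B) dg K b * me K b <= k%:R * F%:R * X + Pp.
  rewrite sum_B_split => [|b d0]; last by rewrite dg_card -/(dK b) d0 mul0r.
  apply: lerD; last first.
    rewrite /Pp; apply: ler_sum => b _; rewrite expr2 dg_card ler_wpM2l //.
    by apply: le_trans (me_le_dg x01 _ _) _; rewrite dg_card.
  rewrite mulrAC mulr_natr -sumr_const.
  apply: ler_sum => b; rewrite inE => /andP[_ /eqP dbk].
  by rewrite dg_card -/(dK b) dbk ler_wpM2l // me_le_mu.
have le2 : lam * \sum_(b in B) dg K b * me B b <= k%:R * D6 * D1.
  apply: le_trans (_ : \sum_(b in B) k%:R * D6 * dg B b <= _); last first.
    by rewrite -mulr_sumr ler_wpM2l // mulr_ge0 // ltW.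
  rewrite mulr_sumr; apply: ler_sum => b bB; rewrite mulrCA -mulrA.
  have me0 : 0 <= lam * me B b by rewrite mulr_ge0 ?me_ge0 // ltW.
  apply: le_trans (_ : k%:R * (lam * me B b) <= _).
    by rewrite ler_wpM2r // dg_card ler_nat dK_le.
  rewrite ler_wpM2l ?(ltW k_gt0) // /me /dg !mulr_sumr; apply: ler_sum => w wB.
  by rewrite mulrCA [D6 * _]mulrC ler_wpM2l ?ind_ge0 ?B_small.
have : lam * ((k%:R * q%:R + r%:R ^+ 2 / k%:R) * X) <=
       lam * ((lam ^+ 2 - (k%:R - 1) * lam) * X).
  by rewrite ler_pM2l // ler_wpM2r.
rewrite sum_K_eig.
have : lam * \sum_(b in B) dg K b * me K b <= lam * (k%:R * F%:R * X + Pp) by rewrite ler_pM2l.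
by move: le2; lra.
Qed.

Lemma squares_ge : (k ^ 2 * q + r ^ 2 <= \sum_(b in B) #|K :&: nbr b| ^ 2)%N.
Proof.
have [D1_ge0 D4_ge0 D6_ge0 D7_ge0] := D_ge0.
(* Both sides are integers, so an error below 1 is harmless. *)
rewrite -ltnS -(ltr_nat R) -[X in _ < X%:R]addn1 !natrD natrM !natrX natr_sum.
under [X in _ < X + _]eq_bigr => b _ do rewrite natrX.
rewrite sum_B_split => [|b d0]; last by rewrite -/(dK b) d0 expr2 mul0r.
rewrite -/Pp; have -> : \sum_(b in full) (#|K :&: nbr b|%:R : R) ^+ 2 = k%:R ^+ 2 * F%:R.
  rewrite mulr_natr -sumr_const; apply: eq_bigr => b.
  by rewrite inE => /andP[_ /eqP dbk]; rewrite -/(dK b) dbk.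
(* [Delta] is what the full vertices leave to the partial ones. There are boundedly many of the
   latter, so [Delta] is bounded and replacing [X] by [k] costs O(1 / lam). *)
pose Delta : R := k%:R * q%:R + r%:R ^+ 2 / k%:R - k%:R * F%:R.
have DeltaE : k%:R * Delta = k%:R ^+ 2 * q%:R + r%:R ^+ 2 - k%:R ^+ 2 * F%:R.
  by rewrite /Delta; field; rewrite gt_eqF.
suff : k%:R * Delta < Pp + 1 by rewrite DeltaE; lra.
have Pp_ge0 : 0 <= Pp by apply: sumr_ge0 => b _; exact: sqr_ge0.
have [D_le0|Delta_gt0] := lerP Delta 0.
  apply: le_lt_trans (_ : 0 < _); last by lra.
  by rewrite mulr_ge0_le0 // ltW.
have Pp_le : Pp <= k%:R ^+ 2 * D7.
  apply: part_le; last exact: sqr_ge0.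
  by move=> b _; rewrite lerXn2r ?nnegrE // ler_nat dK_le.
have k3 : (3 : R) <= k%:R by rewrite ler_nat.
have E_ge0 : 0 <= k%:R * D6 * D1 by rewrite !mulr_ge0 // ltW.
have kD_ge0 : 0 <= k%:R * D4 by rewrite mulr_ge0 // ltW.
have lam2 : lam <= lam ^+ 2 by rewrite expr2 ler_peMl // ltW.
have X_ge1 : 1 <= X.
  have : lam * (k%:R - X) <= k%:R * D4.
    by apply: le_trans X_ge; rewrite ler_wpM2r // subr_ge0.
  have : k%:R * D4 * 1 <= k%:R * D4 * (k%:R ^+ 2 * D7 + 1).
    by rewrite ler_wpM2l // lerDr mulr_ge0 ?sqr_ge0.
  have : lam * 1 <= lam * 1 by [].
  rewrite -(ler_pM2l lam_gt0); have : lam * 3 <= lam * k%:R by rewrite ler_pM2l.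
  by have := lam_large2; lra.
have Delta_le : lam * Delta <= lam * (k%:R ^+ 2 * D7 + 1).
  apply: le_trans (_ : lam * (Delta * X) <= _).
    by rewrite ler_pM2l // ler_peMr // ltW.
  apply: le_trans main_le _; have : lam * Pp <= lam * (k%:R ^+ 2 * D7) by rewrite ler_pM2l.
  by have := lam_large1; lra.
have {}Delta_le : Delta <= k%:R ^+ 2 * D7 + 1 by rewrite ler_pM2l in Delta_le.
rewrite -(ltr_pM2l lam_gt0).
have : lam * ((k%:R - X) * Delta) <= k%:R * D4 * (k%:R ^+ 2 * D7 + 1).
  rewrite mulrA; apply: ler_pM => //; try exact: ltW.
    by rewrite mulr_ge0 ?subr_ge0 // ltW.
  by apply: le_trans X_ge; rewrite ler_wpM2r // subr_ge0.
by have := main_le; rewrite -/Delta; have := lam_large1; have := lam_large2; lra.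
Qed.

End Squares.

(** * Conclusion *)

Lemma threshold (R : archiRealFieldType) (s : seq R) :
  exists L : nat, forall lam : R, L%:R <= lam -> all (fun c => c < lam) s.
Proof.
elim: s => [|c s [L HL]]; first by exists 0%N.
exists (maxn L (Num.bound `|c|)) => lam; rewrite /= natr_max ge_max => /andP[L1 L2].
rewrite HL // andbT; apply: le_lt_trans (ler_norm c) _.
by apply: lt_le_trans L2; apply: archi_boundP.
Qed.

(** * Choice of the constants *)

Section Asymptotics.
Variables (R : archiRealFieldType) (k : nat).
Hypothesis k_ge3 : (3 <= k)%N.
Local Notation p := (k%:R : R).
(** This is binom(k, 2) + k/4, where k/4 is the maximum of r - r^2/k over real r. *)
Let C : R := 2^-1 * (p * (p - 1) + 2^-1 * p).
Let kap : R := p^-1.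
Let p_ge3 : 3 <= p.
Proof. by rewrite ler_nat. Qed.
Let p_kap : p * kap = 1.
Proof. by rewrite divff // gt_eqF //; have := p_ge3; lra. Qed.
Let kap_gt0 : 0 < kap.
Proof. by rewrite invr_gt0; have := p_ge3; lra. Qed.
Let kap_le : kap <= 3^-1.
Proof. by rewrite lef_pV2 ?posrE //; have := p_ge3; lra. Qed.
Let C_ge0 : 0 <= C.
Proof.
have p3 := p_ge3; have h : 0 <= p * (p - 1) by apply: mulr_ge0; lra.
by rewrite /C; lra.
Qed.

Let tau : R := kap * kap / 16.
Let t0 : R := kap / 24.
Let c : R := tau * t0 / 2.
Let d : R := c * tau / 4.

Let params : [/\ 0 < t0, 0 < tau, 0 < c & 0 < d].
Proof.
have h0 : 0 < t0 by rewrite divr_gt0.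
have h1 : 0 < tau by apply: divr_gt0 => //; apply: mulr_gt0.
have h2 : 0 < c by apply: divr_gt0 => //; apply: mulr_gt0.
by split=> //; apply: divr_gt0 => //; apply: mulr_gt0.
Qed.

Let bounds : [/\ t0 <= 72^-1, tau <= 144^-1, c <= 144^-1 * t0 & d <= 144^-1 * c].
Proof.
have [h0 h1 h2 h3] := params.
have b1 : tau <= 144^-1.
  have : kap * kap <= 3^-1 * 3^-1 by apply: ler_pM => //; exact: ltW.
  by rewrite /tau; lra.
split=> //; first by rewrite /t0; have := kap_le; lra.
  have : tau * t0 <= 144^-1 * t0 by rewrite ler_pM2r.
  by rewrite /c; lra.
have : tau * c <= 144^-1 * c by rewrite ler_pM2r.
by rewrite /d; lra.
Qed.

Lemma few_far : exists L : nat, forall (G : sgraph) (lam : R) (x : G -> R) (u : G),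
  perron_pair lam x u -> subgraph_free (wheel (2 * k + 1)) G ->
  \sum_v \sum_w @ind R G v w - 2 * C <= 2 * (lam ^+ 2 - (k%:R - 1) * lam) ->
  L%:R <= lam -> mu x (far u) <= kap / 12 * lam.
Proof.
have [h0 h1 h2 h3] := params; have [b0 b1 b2 b3] := bounds.
have d1 : d <= 1 by lra.
pose M1 := Num.bound (2 * p / d ^+ 2); pose M2 := Num.bound (2 * p / c).
have M1P : 2 * p <= d ^+ 2 * M1%:R.
  rewrite [d ^+ 2 * _]mulrC -ler_pdivrMr ?exprn_gt0 //.
  have H : 0 <= 2 * p / d ^+ 2 by apply: divr_ge0; [apply: mulr_ge0 | apply: sqr_ge0].
  by have /ltW := archi_boundP H.
have M2P : 2 * p <= c * M2%:R.
  rewrite [c * _]mulrC -ler_pdivrMr //.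
  have H : 0 <= 2 * p / c by apply: divr_ge0; [apply: mulr_ge0 | apply: ltW].
  by have /ltW := archi_boundP H.
pose cst1 : R := (M1 * (2 ^ M1 * k))%:R; pose cst2 : R := (M2 * (2 ^ M2 * k))%:R.
have [L HL] := threshold [:: 1; (cst1 + 2 * C) / d ^+ 2; cst1; cst2;
  2 * (p + 1); 1 / d; 2 * p / c; 1 / (tau * t0); 16 * (C + cst2) / t0].
have tau_t0 : 0 < tau * t0 by apply: mulr_gt0.
exists L => G lam x u P free slack /HL /=.
rewrite !ltr_pdivrMr ?exprn_gt0 //.
move=> /and5P[l1 l2 l3 l4 /and5P[l5 l6 l7 l8 /andP[l9 _]]].
have lam_gt0 : 0 < lam by lra.
have rest : mu x (far u :\: twins lam x u d) <= 5 * d * lam.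
  apply: (mu_far_nontwins (M := M1) P k_ge3 free slack) => //.
  - by rewrite h3.
  - rewrite -/cst1 (ger0_norm C_ge0) [d ^+ 2 * _]mulrC; apply: ltW.
    apply: lt_le_trans l2 _; rewrite ler_pM2r ?exprn_gt0 //.
    by rewrite expr2 ler_peMl // ltW.
  - exact: ltW.
have kd : k%:R * d = kap * (t0 * tau) / 128.
  transitivity ((k%:R * kap) * (kap * tau * t0 / 128)); last by rewrite p_kap; ring.
  by rewrite /d /c {1}/tau; field.
have ktau : k%:R * tau = kap / 16.
  transitivity ((k%:R * kap) * (kap / 16)); last by rewrite p_kap mul1r.
  by rewrite /tau; field.
have kc : k%:R * c = kap * t0 / 32.
  by rewrite /c mulrA mulrA ktau; field.
have kt_0 : 0 < kap * t0 by apply: mulr_gt0.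
have kt_1 : kap * t0 <= 3^-1 * t0 by rewrite ler_pM2r.
have tt_0 : 0 < t0 * tau by apply: mulr_gt0.
have tt_1 : t0 * tau <= 72^-1 * 144^-1 by apply: ler_pM => //; exact: ltW.
have ktt_0 : 0 < kap * (t0 * tau) by apply: mulr_gt0.
have ktt_1 : kap * (t0 * tau) <= 3^-1 * (t0 * tau) by rewrite ler_pM2r.
(* Either there are at least t0 lam twins, which [twins_not_many] excludes, or their mass is below
   t0 lam; since kap / 12 = 2 t0, another t0 lam is available for the remaining far vertices. *)
have [big|small] := lerP (t0 * lam) #|twins lam x u d|%:R.
  exfalso; have ts : t0 * lam * tau <= #|twins lam x u d|%:R * tau by rewrite ler_pM2r.
  apply: (twins_not_many P k_ge3 free slack (twins_far lam x u d) _ _ rest big h3 h1 h2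
    _ _ _ _ _ _ _ _ M2P) => //; try exact: ltW.
  - by move=> w; apply: me_N_twin P d w.
  - by move=> w; rewrite inE => /and3P[].
  - have -> : 8 * (k%:R + 1) * d = 8 * (k%:R * d) + 8 * d by ring.
    by rewrite kd; lra.
  - have -> : 16 * (k%:R + 1) * k%:R * tau = 16 * k%:R * (k%:R * tau) + 16 * (k%:R * tau) by ring.
    rewrite ktau; have -> : 16 * k%:R * (kap / 16) = k%:R * kap by field.
    by rewrite p_kap; have := kap_le; lra.
  - have -> : 2 * k%:R * tau = kap / 8 by rewrite -mulrA ktau; field.
    by have : t0 = kap / 24 by []; lra.
  - by rewrite /d; lra.
  - by rewrite /c; lra.
  - by rewrite -mulrA kc; lra.
  - have -> : 32 * k%:R ^+ 2 * d = 32 * k%:R * (k%:R * d) by ring.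
    rewrite kd; have -> : 32 * k%:R * (kap * (t0 * tau) / 128) = (k%:R * kap) * (t0 * tau) / 4 by field.
    rewrite p_kap mul1r; have : t0 * tau <= t0 * 144^-1 by rewrite ler_pM2l.
    by lra.
  - have -> : 2 * k%:R * (2 * d + 2 * k%:R * tau) = 4 * (k%:R * d) + 4 * k%:R * (k%:R * tau) by ring.
    rewrite kd ktau; have -> : 4 * k%:R * (kap / 16) = (k%:R * kap) / 4 by field.
    by rewrite p_kap; lra.
  - by move: l6; rewrite mulrC => /ltW.
  - by move: l7; rewrite [lam * _]mulrC => /ltW.
  - by move: l8 ts; lra.
  - by rewrite [t0 * lam]mulrC.
  - by lra.
have muT : mu x (twins lam x u d) <= t0 * lam.
  by apply: le_trans (mu_le_card (pp_x01 P) _) (ltW small).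
have -> : mu x (far u) = mu x (twins lam x u d) + mu x (far u :\: twins lam x u d).
  exact: sum_setD (twins_far lam x u d).
have : 5 * d * lam <= t0 * lam by rewrite ler_pM2r //; lra.
have -> : kap / 12 * lam = 2 * (t0 * lam) by rewrite /t0; field.
by lra.
Qed.

Lemma core_exists : exists L : nat, forall (G : sgraph) (lam : R) (x : G -> R) (u : G) (q r : nat),
  perron_pair lam x u -> subgraph_free (wheel (2 * k + 1)) G ->
  \sum_v \sum_w @ind R G v w = p * (p - 1) + 2 * (p * q%:R + r%:R) ->
  p * q%:R + r%:R ^+ 2 / p <= lam ^+ 2 - (p - 1) * lam ->
  L%:R <= lam -> exists K : {set G},
    [/\ #|K| = k, {in K &, forall y z, y != z -> adj y z} &
      (k ^ 2 * q + r ^ 2 <= \sum_(b in ~: K) #|K :&: nbr b| ^ 2)%N].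
Proof.
have p3 := p_ge3; have kap0 := kap_gt0.
have [L1 HL1] := few_far.
(* [32 * k] solves 2k <= c M for the popularity threshold c = 1/16; [eps] is the bound supplied by
   [few_far]. *)
pose M := (32 * k)%N; pose cst : R := (M * (2 ^ M * k))%:R.
have cst_ge0 : 0 <= cst by exact: ler0n.
pose eps := kap / 12.
have eps_gt0 : 0 < eps by apply: divr_gt0.
pose D1 := 2 * C + 2 * cst + M%:R ^+ 2 + 1; pose D2 := 5 * D1 + p ^+ 2.
pose D3 := 2 + p + 2 * D1 + D2; pose D4 := 2 * D1 * D3.
pose D6 := D3 + 3 * D1; pose D7 := p * (2 * D4 + 3 * D1) + D1.
have D1_ge1 : 1 <= D1 by rewrite /D1; have := C_ge0; have := sqr_ge0 (M%:R : R); lra.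
have D3_ge0 : 0 <= D3 by rewrite /D3 /D2; have := sqr_ge0 p; lra.
have D4_ge0 : 0 <= D4 by rewrite /D4 mulr_ge0 //; lra.
have D7_ge0 : 0 <= D7 by apply: addr_ge0; [apply: mulr_ge0 => //|]; lra.
have [L2 HL2] := threshold [:: 1; cst; 1 / eps; D1 / (eps * 16^-1); 5 * D1 / eps; 4 * p;
  2 * cst; 4 * (p ^+ 2 * D4 + 3 * D1); 2 * (p * D6 * (5 * D1));
  2 * (p * D4 * (p ^+ 2 * D7 + 1))].
exists (maxn L1 L2) => G lam x u q r P free sum_ind sharp.
rewrite natr_max ge_max => /andP[L1_le /HL2].
have eps16 : 0 < eps * 16^-1 by apply: divr_gt0.
rewrite /= !ltr_pdivrMr //.
move=> /and5P[l1 l2 l3 l4 /and5P[l5 l6 l7 l8 /and3P[l9 l10 _]]].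
have lam_gt0 : 0 < lam by lra.
have slack : \sum_v \sum_w @ind R G v w - 2 * C <= 2 * (lam ^+ 2 - (k%:R - 1) * lam).
  (* This square is the estimate r - r^2/k <= k/4 behind [C]. *)
  have : 0 <= (p - 2 * r%:R) ^+ 2 * p^-1 by rewrite mulr_ge0 ?sqr_ge0 // invr_ge0.
  have -> : (p - 2 * r%:R) ^+ 2 * p^-1 = p - 4 * r%:R + 4 * (r%:R ^+ 2 / p).
    by field; rewrite gt_eqF //; lra.
  by rewrite sum_ind /C; lra.
have muW := HL1 G lam x u P free slack L1_le.
have eps_k : 12 * p * eps <= 1.
  have -> : 12 * p * eps = p * kap by rewrite /eps; field.
  by rewrite p_kap.
have c_eps : 16^-1 + 2 * eps <= 4^-1 by rewrite /eps; have := kap_le; lra.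
have cM : 2 * p <= 16^-1 * M%:R by rewrite /M natrM; lra.
have [K [cardK K_clique K_near1 B_small [B_edges B_partial]]] :
  exists K : {set G}, [/\ #|K| = k, {in K &, forall y z, y != z -> adj y z},
    {in K, forall z, lam ^+ 2 * (1 - x z) <= D4},
    {in ~: K, forall b, lam * x b <= D6} &
    \sum_(b in ~: K) dg R (~: K) b <= 5 * D1 /\
    #|[set b in ~: K | (0 < #|K :&: nbr b| < k)%N]|%:R <= D7].
  apply: (core_structure P k_ge3 free slack (c := 16^-1) (eps := eps) (M := M)
    (D1 := D1) (D2 := D2) (D3 := D3) (D4 := D4)) => //; try exact: ltW.
  - by lra.
  - by rewrite -/cst /D1; lra.
  - by move: l3; lra.
  - by move: l4; lra.
  - by move: l5; lra.
  - by rewrite /C; lra.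
  - by rewrite /D6; lra.
  - by rewrite /D6; lra.
exists K; split=> //.
apply: (@squares_ge R G k q r lam x u P k_ge3 K (5 * D1) D4 D6 D7) => //.
- exact: ltW.
- by split=> //; rewrite /D6; lra.
Qed.

End Asymptotics.

(** * Identification of the extremal graph *)

Lemma connected_nbr (G : sgraph) (v w : G) :
  connected_graph G -> v != w -> exists z, adj v z.
Proof.
move=> [_ conn] vw; have /connectP[s] := conn v w.
case: s => [|z s] /=; first by move=> _ E; rewrite E eqxx in vw.
by case/andP => vz _ _; exists z.
Qed.

Lemma isomorphic_sym (G H : sgraph) : isomorphic G H -> isomorphic H G.
Proof.
move=> [f [[g fK gK] f_adj]]; exists g; split; first by exists f.
by move=> x y; rewrite -f_adj !gK.
Qed.

Lemma card_nbr (G : sgraph) (A : {set G}) (v : G) :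
  #|A :&: nbr v| = (\sum_(w in A) (adj v w : nat))%N.
Proof.
rewrite -sum1_card big_mkcond [RHS]big_mkcond; apply: eq_bigr => w _.
by rewrite !inE; case: (w \in A); case: adj.
Qed.

Lemma sum_adj_split (G : sgraph) (K : {set G}) :
  {in K &, forall y z, y != z -> adj y z} ->
  (\sum_(v : G) \sum_(w : G) (adj v w : nat) =
   #|K| * #|K|.-1 + (2 * \sum_(b in ~: K) #|K :&: nbr b| +
   \sum_(b in ~: K) #|(~: K) :&: nbr b|))%N.
Proof.
move=> K_clique.
have split (F : G -> nat) : (\sum_v F v = \sum_(v in K) F v + \sum_(v in ~: K) F v)%N.
  by rewrite (bigID (mem K)) /=; congr (_ + _)%N; apply: eq_bigl => v; rewrite ?inE.
have row v : (\sum_w (adj v w : nat) = #|K :&: nbr v| + #|(~: K) :&: nbr v|)%N.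
  by rewrite split !card_nbr.
rewrite (eq_bigr _ (fun v _ => row v)) split !big_split /=.
have -> : (\sum_(v in K) #|(~: K) :&: nbr v| = \sum_(b in ~: K) #|K :&: nbr b|)%N.
  under eq_bigr => v _ do rewrite card_nbr.
  rewrite exchange_big; apply: eq_bigr => b _; rewrite card_nbr.
  by apply: eq_bigr => v _; rewrite adj_sym.
have -> : (\sum_(v in K) #|K :&: nbr v| = #|K| * #|K|.-1)%N.
  rewrite -sum_nat_const; apply: eq_bigr => v vK.
  have -> : K :&: nbr v = K :\ v.
    apply/setP => w; rewrite !inE andbC; case: (eqVneq w v) => [->|wv] /=.
      by rewrite adj_irrefl.
    by case: (boolP (w \in K)) => [wK|]; rewrite ?andbF // K_clique // eq_sym.
  by rewrite (cardsD1 v K) vK.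
by lia.
Qed.

(** Because rho G >= rho S alone forces the isomorphism, the inequality and its equality case will
    follow together. *)
Lemma extremal_iso (k : nat) : (3 <= k)%N ->
  exists m0 : nat, forall m q r : nat, (m0 <= m)%N ->
    m = ('C(k, 2) + k * q + r)%N -> (1 <= r <= k - 1)%N ->
    forall G : sgraph, connected_graph G ->
      subgraph_free (wheel (2 * k + 1)) G -> #|edges G| = m ->
      rhoR (S_graph k q r) <= rhoR G -> isomorphic G (S_graph k q r).
Proof.
move=> k3; have [L HL] := @core_exists algR k k3.
have k1 : (3 : algR) <= k%:R by rewrite ler_nat.
(* As binom(k, 2) <= k^2 and r < k, this makes kq at least L^2, and lam^2 >= kq then gives lam >=
   L. *)
exists (L ^ 2 + k ^ 2 + k)%N => m q r m_ge mE /andP[r1 rk] G conn free edgesE rho_ge.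
have rk' : (r <= k)%N by lia.
have [G_gt0 _] := conn; have [x [u [x01 xu eig]]] := perron G_gt0.
have [sharp_S rho_S] := rho_S_ge q k3 rk'.
set lam := rhoR G in rho_ge eig *; set rho := rhoR (S_graph k q r) in rho_ge sharp_S rho_S *.
have sharp : k%:R * q%:R + r%:R ^+ 2 / k%:R <= lam ^+ 2 - (k%:R - 1) * lam.
  (* The map t -> t^2 - (k-1) t is increasing from t = k-1 on, where both radii lie. *)
  apply: le_trans sharp_S _; rewrite -subr_ge0.
  have -> : lam ^+ 2 - (k%:R - 1) * lam - (rho ^+ 2 - (k%:R - 1) * rho) =
    (lam - rho) * (lam + rho - (k%:R - 1)) by ring.
  by apply: mulr_ge0; lra.
have lam_gt0 : 0 < lam by lra.
have bin_le : ('C(k, 2) <= k ^ 2)%N by rewrite bin2 expnS expn1; nia.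
have L_le : L%:R <= lam.
  rewrite -(@ler_pXn2r _ 2) ?nnegrE // ?(ltW lam_gt0) //.
  have : (L ^ 2)%:R <= k%:R * q%:R :> algR by rewrite -natrM ler_nat; lia.
  rewrite natrX; have : 0 <= r%:R ^+ 2 / k%:R :> algR by rewrite divr_ge0 ?sqr_ge0.
  have : 0 <= (k%:R - 1) * lam by apply: mulr_ge0; lra.
  by move: sharp; lra.
have P : perron_pair lam x u by split.
have two_edges : (\sum_(v : G) \sum_(w : G) (adj v w : nat) = k * k.-1 + 2 * (k * q + r))%N.
  have bin_k : (2 * 'C(k, 2) = k * k.-1)%N by rewrite -mul_bin_diag bin1.
  by rewrite sum_adj_edges edgesE mE -addnA mulnDr bin_k.
have sum_ind : \sum_v \sum_w @ind algR G v w = k%:R * (k%:R - 1) + 2 * (k%:R * q%:R + r%:R).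
  transitivity ((\sum_(v : G) \sum_(w : G) (adj v w : nat))%N%:R : algR).
    by rewrite natr_sum; apply: eq_bigr => v _; rewrite natr_sum.
  rewrite two_edges !(natrD, natrM) -subn1 natrB //; exact: leq_trans k3.
have [K [cardK K_clique sq_ge]] := HL G lam x u q r P free sum_ind sharp L_le.
pose d b := #|K :&: nbr b|; pose S := (\sum_(b in ~: K) #|(~: K) :&: nbr b|)%N.
have count : (2 * \sum_(b in ~: K) d b + S = 2 * (k * q + r))%N.
  by have := sum_adj_split K_clique; rewrite two_edges cardK -/S => /addnI ->.
(* By [count], the deficit is the number of edges inside the complement of [K]: S = 2 e. *)
pose e := (k * q + r - \sum_(b in ~: K) d b)%N.
have sum_d : (\sum_(b in ~: K) d b + e = k * q + r)%N by rewrite /e; lia.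
have d_le : {in ~: K, forall b, (d b <= k)%N}.
  by move=> b _; rewrite /d -cardK subset_leq_card ?subsetIl.
have r_lt : (0 < r < k)%N by lia.
have [e0 [b0 b0B [d0 d_others]]] := deficit_unique r_lt d_le sum_d sq_ge.
have S0 : S = 0%N by lia.
have B_indep : {in ~: K &, forall y z, ~~ adj y z}.
  move=> y z yB zB; apply/negP => yz; have := S0; rewrite /S (bigD1 y) //=.
  move/eqP; rewrite addn_eq0 cards_eq0 => /andP[/eqP/setP/(_ z) + _].
  by rewrite in_setI zB inE yz in_set0.
have B_full : {in ~: K, forall b, b != b0 -> d b = k}.
  (* The value 0 would make [b] isolated, against connectedness. *)
  move=> b bB b_neq; have [d_b|//] := d_others b bB b_neq.
  have [z bz] := connected_nbr conn b_neq.
  have : z \notin K :&: nbr b by have /eqP := d_b; rewrite cards_eq0 => /eqP->; rewrite inE.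
  rewrite in_setI [z \in nbr b]inE bz andbT -in_setC => zB.
  by have := B_indep _ _ bB zB; rewrite bz.
have cardB : #|~: K| = q.+1.
  have := cardsD1 b0 (~: K); rewrite b0B add1n => ->; congr _.+1.
  move: sum_d; rewrite e0 addn0 (big_setD1 b0) //= d0.
  rewrite (eq_bigr (fun=> k)) => [|b /setD1P[b_neq bB]]; last exact: B_full.
  by rewrite sum_nat_const; nia.
apply: (@S_graph_iso G K b0) => //.
- by have := cardsC K; rewrite cardK cardB; lia.
- by rewrite inE in b0B.
- move=> b bB b_neq z zK; have /eqP := B_full b bB b_neq.
  rewrite -cardK /d => /eqP card_eq.
  have /eqP/setP/(_ z) : K :&: nbr b == K by rewrite eqEcard subsetIl card_eq leqnn.
  by rewrite in_setI zK inE adj_sym.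
Qed.

Theorem theorem1p2 (k : nat) (hk : (3 <= k)%N) :
  exists m0 : nat, forall m q r : nat,
    (m0 <= m)%N ->
    m = ('C(k, 2) + k * q + r)%N ->
    (1 <= r <= k - 1)%N ->
    forall G : sgraph,
      connected_graph G ->
      subgraph_free (wheel (2 * k + 1)) G ->
      #|edges G| = m ->
      (rho G <= rho (S_graph k q r))%R /\
      (rho G = rho (S_graph k q r) <-> isomorphic G (S_graph k q r)).
Proof.
have [m0 iso] := extremal_iso hk; exists m0 => m q r m_ge mE r_bd G conn free edgesE.
have {}iso := iso m q r m_ge mE r_bd G conn free edgesE.
have iso_eq : isomorphic G (S_graph k q r) -> rhoR G = rhoR (S_graph k q r).
  by move=> GS; apply/eqP; rewrite eq_le !rho_iso_le //; apply: isomorphic_sym.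
have le_rho : rhoR G <= rhoR (S_graph k q r).
  (* A strictly larger radius would force the isomorphism, hence equal radii. *)
  rewrite leNgt; apply/negP => lt_rho.
  by have := iso_eq (iso (ltW lt_rho)); move: lt_rho => /[swap] ->; rewrite ltxx.
split; first exact: le_rho.
split=> [E|/iso_eq/(congr1 algRval) //].
by apply: iso; rewrite le_eqVlt; apply/orP; left; apply/eqP/val_inj.
Qed.
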